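(* Let $\mathcal H\subseteq\mathcal Y^{\mathcal X}$ be a hypothesis class. Let $k(\mathcal H)$ be the smallest integer $k$ for which $\mathcal H$ is $k$-list PAC learnable, and assume $k(\mathcal H)<\infty$. Let $\gamma(\mathcal H)$ be the supremum over $\gamma\in[0,1]$ for which $\mathcal H$ is $\gamma$-weak PAC learnable. Then $$k(\mathcal H)\cdot\gamma(\mathcal H)=1 .$$
   Context: A distribution $\mathcal D$ over $\mathcal X\times\mathcal Y$ is $\mathcal H$-realizable if $\inf_{h\in\mathcal H}\Pr_{(x,y)\sim\mathcal D}[h(x)\neq y]=0$. For $\mu:\mathcal X\to\mathcal Y^k$, $y\in\mu(x)$ means $y$ is one of the $k$ entries of $\mu(x)$. $k$-list PAC learnability ($k$ a positive integer): there is an algorithm and a function $m(\epsilon,\delta)$ such that for every $\mathcal H$-realizable $\mathcal D$ and every $\epsilon,\delta>0$, given $S\sim\mathcal D^m$ with $m\ge m(\epsilon,\delta)$, it returns $\mu_S:\mathcal X\to\mathcal Y^k$ such that with probability at least $1-\delta$, $\Pr_{(x,y)\sim\mathcal D}[y\in\mu_S(x)]\ge1-\epsilon$. $\gamma$-weak PAC learnability: there is an algorithm and a function $m(\delta)$ such that for every $\mathcal H$-realizable $\mathcal D$ and every $\delta>0$, given $S\sim\mathcal D^m$ with $m\ge m(\delta)$, it returns $h_S:\mathcal X\to\mathcal Y$ such that with probability at least $1-\delta$, $\Pr_{(x,y)\sim\mathcal D}[y=h_S(x)]\ge\gamma$. An algorithm here is a (possibly randomized) map from finite samples to outputs of the stated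 type. *)

(* Defs.v *)
From HB Require Import structures.
From mathcomp Require Import all_boot all_order all_algebra.
From mathcomp Require Import all_classical all_reals all_analysis.

Set Implicit Arguments.
Unset Strict Implicit.
Unset Printing Implicit Defensive.
Import Order.TTheory GRing.Theory Num.Theory.
Local Open Scope classical_set_scope.
Local Open Scope ring_scope.
Local Open Scope ereal_scope.

Section iid.
Context {d : measure_display} {Z : measurableType d} {R : realType}.

Definition cons_sample (m : nat) (p : Z * m.-tuple Z) : m.+1.-tuple Z :=
  [tuple of p.1 :: p.2].

Lemma measurable_cons_sample m : measurable_fun setT (@cons_sample m).
Proof. exact: measurable_cons. Qed.

HB.instance Definition _ m :=
  isMeasurableFun.Build _ _ _ _ (@cons_sample m) (@measurable_cons_sample m).

(* The product measure D^m on m-tuples. *)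
Fixpoint iid (D : probability Z R) (m : nat) : probability (m.-tuple Z) R :=
  match m with
  | 0 => \d_[tuple]
  | m'.+1 => distribution (D \x iid D m') (@cons_sample m')
  end.

End iid.

(* A randomized map taking a sample of m points of Z to a function X -> O: the
   internal randomness is a seed drawn, independently of the sample, from an
   arbitrary probability space. Once the sample and the seed are fixed, the
   output is a single function. Joint measurability of the evaluation makes the
   error and success events below measurable. *)
Record randomized_map (R : realType) (dZ dX dO : measure_display)
    (Z : measurableType dZ) (X : measurableType dX) (O : measurableType dO)
    (m : nat) := RandomizedMap {
  seed_display : measure_display;
  seed : measurableType seed_display;
  seed_law : probability seed R;
  output : m.-tuple Z -> seed -> X -> O;
  measurable_output : measurable_fun setT
    (fun p : m.-tuple Z * seed * X => output p.1.1 p.1.2 p.2)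
}.

Definition algorithm (R : realType) (dZ dX dO : measure_display)
    (Z : measurableType dZ) (X : measurableType dX) (O : measurableType dO) :=
  forall m : nat, randomized_map R Z X O m.

Section learnability.
Context (R : realType) {dX dY : measure_display}
  {X : measurableType dX} {Y : measurableType dY}.
Implicit Types (H : set (X -> Y)) (D : probability (X * Y)%type R).

(* Probability, over a sample from D^m and the seed, that the output of the
   algorithm on samples of size m satisfies G. *)
Definition output_prob (dO : measure_display) (O : measurableType dO)
    (A : algorithm R (X * Y)%type X O) D (m : nat) (G : set (X -> O)) : \bar R :=
  (iid D m \x seed_law (A m)) [set p | G (output p.1 p.2)].

(* ereal_inf gives +oo on the empty class, which thus realizes no D. *)
Definition realizable H D :=
  ereal_inf [set D [set z | h z.1 <> z.2] | h in H] = 0.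

Definition list_PAC_learnable H (k : nat) :=
  exists (A : algorithm R (X * Y)%type X (k.-tuple Y)) (m : R -> R -> nat),
  forall D, realizable H D ->
  forall eps delta : R, (0 < eps)%R -> (0 < delta)%R ->
  forall n : nat, (m eps delta <= n)%N ->
  (1 - delta)%:E <= output_prob A D n
    [set mu : X -> k.-tuple Y | (1 - eps)%:E <= D [set z | z.2 \in mu z.1]].

Definition weak_PAC_learnable H (gamma : R) :=
  exists (A : algorithm R (X * Y)%type X Y) (m : R -> nat),
  forall D, realizable H D ->
  forall delta : R, (0 < delta)%R ->
  forall n : nat, (m delta <= n)%N ->
  (1 - delta)%:E <= output_prob A D n
    [set h : X -> Y | gamma%:E <= D [set z | z.2 = h z.1]].

Definition list_number_finite H :=
  exists k : nat, `[< (0 < k)%N /\ list_PAC_learnable H k >].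

Definition list_number H (fin : list_number_finite H) : nat := ex_minn fin.

Definition weak_number H : R :=
  sup [set gamma : R | (0 <= gamma <= 1)%R /\ weak_PAC_learnable H gamma].

End learnability.

(* Main.v *)
Require Import Defs.
From HB Require Import structures.
From mathcomp Require Import all_boot all_order all_algebra.
From mathcomp Require Import all_classical all_reals all_analysis.
From mathcomp Require Import measurable_realfun zify ring lra.

(**
Write k for the list number.  If h_1, ..., h_k are the coordinates of a k-list
of accuracy 1 - eps, one of them has accuracy at least (1 - eps) / k, and a
fresh validation sample finds one that is nearly as good: H is gamma-weakly
learnable for every gamma < 1 / k.

Conversely, let H be gamma-weakly learnable with K gamma > 1.  Multiplicative
weights are run on the population: after hypotheses h_1, ..., h_t, reweight D by
w(x, y) = beta^#{i | h_i(x) = y}.  The reweighted law is again realizable, so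
the weak learner succeeds on samples from it, and each success multiplies the
potential E_D[w] by at most q = 1 - (1 - beta) gamma.  For a suitable beta one
has q^K < beta, so after K c successful rounds Markov's inequality bounds the
mass of the examples whose label got at most c votes by (q^K / beta)^c; and
fewer than K labels can get more than c of the K c votes.  The learner only sees
samples from D, but the density of the reweighted law is bounded, so samples
from D make every round succeed with a probability that is tiny but uniform in
D.  Repetition followed by validation turns this into a (K - 1)-list learner.
*)

Import Order.TTheory GRing.Theory Num.Theory.
Local Open Scope classical_set_scope.
Local Open Scope ring_scope.

Set Implicit Arguments.
Unset Strict Implicit.
Unset Printing Implicit Defensive.
Local Open Scope ereal_scope.

(** * Product measures and samples *)

Lemma measurable_preim d1 d2 (T1 : measurableType d1) (T2 : measurableType d2)
    (f : T1 -> T2) (B : set T2) :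
  measurable_fun setT f -> measurable B -> measurable [set x | B (f x)].
Proof. by move=> mf mB; rewrite -[X in measurable X]setTI; exact: mf. Qed.

Lemma product_measure1_section d1 d2 (T1 : measurableType d1)
    (T2 : measurableType d2) (R : realType)
    (m1 : {measure set T1 -> \bar R}) (m2 : set T2 -> \bar R) (A : set (T1 * T2)) :
  (m1 \x m2) A = \int[m1]_x m2 [set y | A (x, y)].
Proof.
rewrite /product_measure1; apply: eq_integral => x _ /=; congr m2.
by apply/seteqP; split=> y /=; rewrite /xsection /= inE.
Qed.

Lemma measurable_fun_section d1 d2 (T1 : measurableType d1)
    (T2 : measurableType d2) (R : realType)
    (m2 : {sigma_finite_measure set T2 -> \bar R}) (A : set (T1 * T2)) :
  measurable A -> measurable_fun setT (fun x => m2 [set y | A (x, y)]).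
Proof.
move=> mA; rewrite (_ : (fun x => _) = m2 \o xsection A).
  exact: measurable_fun_xsection.
apply/funext => x /=; congr (m2 _).
by apply/seteqP; split=> y /=; rewrite /xsection /= inE.
Qed.

Lemma measurable_set_ge d (T : measurableType d) (R : realType) (f : T -> R)
    (r : R) : measurable_fun setT f -> measurable [set t | (r <= f t)%R].
Proof.
move=> mf; rewrite (_ : [set t | _] = f @^-1` `[r, +oo[).
  by rewrite -[X in measurable X]setTI; exact: mf.
by apply/seteqP; split=> t /=; rewrite in_itv/= andbT.
Qed.

Lemma measurable_set_gt d (T : measurableType d) (R : realType) (f : T -> R)
    (r : R) : measurable_fun setT f -> measurable [set t | (r < f t)%R].
Proof.
move=> mf; rewrite (_ : [set t | _] = f @^-1` `]r, +oo[).
  by rewrite -[X in measurable X]setTI; exact: mf.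
by apply/seteqP; split=> t /=; rewrite in_itv/= andbT.
Qed.

Lemma integral_cst_probability d (T : measurableType d) (R : realType)
    (P : probability T R) (r : \bar R) : \int[P]_x r = r.
Proof.
rewrite integral_cst//; transitivity (r * P setT); first by [].
by rewrite probability_setT mule1.
Qed.

Lemma measurable_section1 d1 d2 (T1 : measurableType d1)
    (T2 : measurableType d2) (A : set (T1 * T2)) (x : T1) :
  measurable A -> measurable [set y | A (x, y)].
Proof. by move=> mA; apply: (measurable_preim _ mA). Qed.

(* Samples of m1 + m2 points are split with mktuples so that the types need no
   arithmetic cast. *)
Definition ltake (T : Type) (m1 m2 : nat) (t : (m1 + m2).-tuple T) : m1.-tuple T :=
  [tuple tnth t (lshift m2 i) | i < m1].
Definition rtake (T : Type) (m1 m2 : nat) (t : (m1 + m2).-tuple T) : m2.-tuple T :=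
  [tuple tnth t (rshift m1 i) | i < m2].

Lemma ltake_cat (T : Type) m1 m2 (a : m1.-tuple T) (b : m2.-tuple T) :
  ltake [tuple of a ++ b] = a.
Proof. by apply: eq_from_tnth => i; rewrite tnth_mktuple tnth_lshift. Qed.

Lemma rtake_cat (T : Type) m1 m2 (a : m1.-tuple T) (b : m2.-tuple T) :
  rtake [tuple of a ++ b] = b.
Proof. by apply: eq_from_tnth => i; rewrite tnth_mktuple tnth_rshift. Qed.

Section tuple_measurability.
Context d (T : measurableType d).

Lemma measurable_mktuple d0 (S : measurableType d0) n (f : 'I_n -> S -> T) :
  (forall i, measurable_fun setT (f i)) ->
  measurable_fun setT (fun x => [tuple f i x | i < n]).
Proof.
move=> mf; apply/measurable_fun_tnthP => i.
by rewrite (_ : _ \o _ = f i)//; apply/funext => x /=; rewrite tnth_mktuple.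
Qed.

Lemma measurable_ltake m1 m2 : measurable_fun setT (@ltake T m1 m2).
Proof. by apply: measurable_mktuple => i; exact: measurable_tnth. Qed.

Lemma measurable_rtake m1 m2 : measurable_fun setT (@rtake T m1 m2).
Proof. by apply: measurable_mktuple => i; exact: measurable_tnth. Qed.

Lemma measurable_cat m1 m2 : measurable_fun setT
  (fun p : m1.-tuple T * m2.-tuple T => [tuple of p.1 ++ p.2]).
Proof.
apply/measurable_fun_tnthP => i; case: (split_ordP i) => j ->.
- rewrite (_ : _ \o _ = (fun t => tnth t j) \o fst).
    by apply: measurableT_comp => //; exact: measurable_tnth.
  by apply/funext => p /=; rewrite tnth_lshift.
- rewrite (_ : _ \o _ = (fun t => tnth t j) \o snd).
    by apply: measurableT_comp => //; exact: measurable_tnth.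
  by apply/funext => p /=; rewrite tnth_rshift.
Qed.

End tuple_measurability.

Section iid_split.
Context d (Z : measurableType d) (R : realType) (D : probability Z R).

(** Induction on [m1]: the first point is peeled off on both sides, and Tonelli reassociates the
    remaining product. *)
Lemma iid_cat m1 m2 (B : set ((m1 + m2).-tuple Z)) : measurable B ->
  iid D (m1 + m2) B = (iid D m1 \x iid D m2) [set p : m1.-tuple Z * m2.-tuple Z | B [tuple of p.1 ++ p.2]].
Proof.
elim: m1 B => [|m1 IH] B mB.
  rewrite product_measure1_section /= integral_dirac//=; last first.
    exact: (measurable_fun_section (iid D m2) (measurable_preim (@measurable_cat _ Z 0 m2) mB)).
  rewrite diracT mul1e; congr (iid D m2 _).
  by apply/seteqP; split => t /=; rewrite (_ : [tuple of _] = t)//; apply: val_inj.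
have mB' := measurable_preim (@measurable_cat _ Z m1.+1 m2) mB.
rewrite product_measure1_section /= (ge0_integral_pushforward (@measurable_cons_sample _ Z m1))//; last first.
  exact: (measurable_fun_section (iid D m2) mB').
rewrite fubini_tonelli1//=; last first.
  apply: (measurableT_comp (measurable_fun_section (iid D m2) mB')).
  exact: measurable_cons_sample.
rewrite product_measure1_section; apply: eq_integral => z _.
rewrite /= /fubini_F /=.
have mz : measurable [set t : (m1 + m2).-tuple Z | B [tuple of z :: t]].
  exact: (measurable_section1 z (measurable_preim (@measurable_cons_sample _ Z (m1 + m2)) mB)).
rewrite [LHS](IH _ mz) product_measure1_section.
apply: eq_integral => a _; congr (iid D m2 _).
apply/seteqP; split => b /=;
  by rewrite (_ : [tuple of z :: _] = [tuple of cons_sample (z, a) ++ b])//; apply: val_inj.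
Qed.

Lemma ge0_integral_iid_cat m1 m2 (f : (m1 + m2).-tuple Z -> \bar R) :
  measurable_fun setT f -> (forall t, 0 <= f t) ->
  \int[iid D (m1 + m2)]_t f t =
  \int[iid D m1]_a \int[iid D m2]_b f [tuple of a ++ b].
Proof.
move=> mf f0.
rewrite (eq_measure_integral (pushforward (iid D m1 \x iid D m2)
    (fun p : m1.-tuple Z * m2.-tuple Z => [tuple of p.1 ++ p.2]))).
- exact: measurable_cat.
- move=> mcat; rewrite (ge0_integral_pushforward mcat)// fubini_tonelli1//=.
  exact: measurableT_comp.
- by move=> mcat B mB _; exact: iid_cat.
Qed.

(** Makes two procedures run on disjoint blocks of one sample, with a pair of seeds, genuinely
    independent: each block travels with its own seed. *)
Lemma iid_seed_cat dS1 dS2 (S1 : measurableType dS1) (S2 : measurableType dS2)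
    (l1 : probability S1 R) (l2 : probability S2 R) m1 m2
    (B : set ((m1.-tuple Z * S1) * (m2.-tuple Z * S2))) :
  measurable B ->
  (iid D (m1 + m2) \x (l1 \x l2))
    [set p | B ((ltake p.1, p.2.1), (rtake p.1, p.2.2))] =
  ((iid D m1 \x l1) \x (iid D m2 \x l2)) B.
Proof.
move=> mB.
(* With the second seed integrated out in [g], the only exchange left to Tonelli is that of the
   first seed with the second block. *)
pose g (q : (m1.-tuple Z * S1) * (m2.-tuple Z)) := l2 [set r | B (q.1, (q.2, r))].
have mB2 : measurable [set q : ((m1.-tuple Z * S1) * (m2.-tuple Z)) * S2 |
    B (q.1.1, (q.1.2, q.2))].
  apply: measurable_preim mB; apply: measurable_fun_pair.
    exact: (measurableT_comp measurable_fst measurable_fst).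
  by apply: measurable_fun_pair => //; exact: (measurableT_comp measurable_snd measurable_fst).
have mg : measurable_fun setT g by exact: measurable_fun_section mB2.
have mB3 : measurable [set q : (m1 + m2).-tuple Z * (S1 * S2) |
    B ((ltake q.1, q.2.1), (rtake q.1, q.2.2))].
  apply: measurable_preim mB; apply: measurable_fun_pair; apply: measurable_fun_pair.
  - by apply: measurableT_comp => //; exact: measurable_ltake.
  - exact: (measurableT_comp measurable_fst measurable_snd).
  - by apply: measurableT_comp => //; exact: measurable_rtake.
  - exact: (measurableT_comp measurable_snd measurable_snd).
transitivity (\int[iid D m1]_a \int[iid D m2]_b \int[l1]_r g ((a, r), b)).
  have mh : measurable_fun setT (fun t : (m1 + m2).-tuple Z => (l1 \x l2)
      [set q | B ((ltake t, q.1), (rtake t, q.2))]).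
    pose l12 : probability (S1 * S2)%type R := l1 \x l2.
    exact: (measurable_fun_section l12 mB3).
  rewrite product_measure1_section.
  rewrite (ge0_integral_iid_cat mh); last by move=> t; exact: measure_ge0.
  apply: eq_integral => a _; apply: eq_integral => b _.
  rewrite product_measure1_section; apply: eq_integral => r _.
  by rewrite ltake_cat rtake_cat.
transitivity (\int[iid D m1]_a \int[l1]_r \int[iid D m2]_b g ((a, r), b)).
  apply: eq_integral => a _.
  rewrite (fubini_tonelli (fun p => g ((a, p.2), p.1)))//.
  apply: (measurableT_comp mg); apply: measurable_fun_pair => //.
  by apply: measurable_fun_pair.
pose P2 : probability (m2.-tuple Z * S2)%type R := iid D m2 \x l2.
rewrite [RHS]product_measure1_section.
rewrite [RHS](fubini_tonelli1 (fun w => (iid D m2 \x l2) [set y | B (w, y)])); last 2 first.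
- exact: (measurable_fun_section P2 mB).
- by move=> w; exact: measure_ge0.
apply: eq_integral => a _; apply: eq_integral => r _.
by rewrite product_measure1_section.
Qed.

End iid_split.

(** * Randomized maps *)

(** Success probabilities of successive stages multiply, even when the goal of the second stage
    depends on the outcome of the first: integrate [c'] times the indicator of [A]. *)
Lemma product_measure1_ge d1 d2 (T1 : measurableType d1) (T2 : measurableType d2)
    (R : realType) (P1 : probability T1 R) (P2 : probability T2 R)
    (A : set T1) (B : set (T1 * T2)) (c c' : R) :
  measurable A -> measurable B -> (0 <= c')%R -> c%:E <= P1 A ->
  (forall x, A x -> c'%:E <= P2 [set y | B (x, y)]) ->
  (c * c')%:E <= (P1 \x P2) B.
Proof.
move=> mA mB c'0 cA c'B; rewrite product_measure1_section.
apply: (@le_trans _ _ (\int[P1]_x (c'%:E * (\1_A x)%:E))).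
  rewrite ge0_integralZl//; last exact/measurable_EFinP.
  by rewrite integral_indic// setIT mulrC EFinM lee_wpmul2l.
apply: ge0_le_integral => //.
- by move=> x _; rewrite -EFinM lee_fin mulr_ge0.
- by apply: measurable_funeM; exact/measurable_EFinP.
- exact: measurable_fun_section mB.
- move=> x _; rewrite indicE; case: (boolP (x \in A)) => [xA|_].
    by rewrite mule1; apply: c'B; rewrite inE in xA.
  by rewrite mule0; exact: measure_ge0.
Qed.

(** Gluing along a finite measurable partition; this is what makes a choice that depends on the data
    measurable. *)
Lemma measurable_fun_finite_case d d' (T : measurableType d)
    (T' : measurableType d') (I : finType) (e : T -> I) (f : I -> T -> T') :
  (forall i, measurable [set t | e t = i]) ->
  (forall i, measurable_fun setT (f i)) ->
  measurable_fun setT (fun t => f (e t) t).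
Proof.
move=> me mf _ B mB; rewrite setTI.
rewrite (_ : _ @^-1` _ = \bigcup_(i in [set: I]) ([set t | e t = i] `&` [set t | B (f i t)])).
  apply: fin_bigcup_measurable; first exact: finite_finset.
  by move=> i _; apply: measurableI => //; exact: measurable_preim (mf i) mB.
apply/seteqP; split=> [t Bt|t [i _ [/= <-]]//].
by exists (e t).
Qed.

Lemma measurable_pattern d (T : measurableType d) (I : finType)
    (Q : I -> set T) (p : {ffun I -> bool}) :
  (forall i, measurable (Q i)) -> measurable [set t | [ffun i => `[< Q i t >]] = p].
Proof.
move=> mQ; rewrite (_ : [set t | _] =
    \bigcap_(i in [set: I]) (if p i then Q i else ~` Q i)).
  apply: fin_bigcap_measurable; first exact: finite_finset.
  by move=> i _; case: (p i) => //; exact: measurableC.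
apply/seteqP; split=> [t /= <- i _|t Qt /=].
  by rewrite ffunE; case: asboolP.
apply/ffunP => i; rewrite ffunE; have := Qt i Logic.I.
by case: (p i) => /= Qit; [exact/asboolP|apply/asboolPn].
Qed.

Section events.
Context (R : realType) (dX dO : measure_display)
  (X : measurableType dX) (O : measurableType dO).

(* Measurability of a set of functions is only meant along jointly measurable
   families: no sigma-algebra on X -> O is involved. *)
Definition measurable_event (G : set (X -> O)) :=
  forall (d : measure_display) (W : measurableType d) (F : W -> X -> O),
  measurable_fun setT (fun p : W * X => F p.1 p.2) -> measurable [set w | G (F w)].

(** [C] says when an output is correct for a label: equality for single predictions, membership for
    lists. Both notions of learning are thus treated at once. *)
Definition accuracy dY (Y : measurableType dY) (D : probability (X * Y)%type R)
    (C : set (O * Y)) (h : X -> O) : \bar R := D [set z | C (h z.1, z.2)].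

Lemma measurable_accurate dY (Y : measurableType dY) (C : set (O * Y)) d
    (W : measurableType d) (F : W -> X -> O) :
  measurable C -> measurable_fun setT (fun p : W * X => F p.1 p.2) ->
  measurable [set q : W * (X * Y) | C (F q.1 q.2.1, q.2.2)].
Proof.
move=> mC mF; apply: measurable_preim mC; apply: measurable_fun_pair.
  have mg : measurable_fun setT (fun q : W * (X * Y) => (q.1, q.2.1)).
    by apply: measurable_fun_pair => //; exact: (measurableT_comp measurable_fst measurable_snd).
  exact: (measurableT_comp mF mg).
exact: (measurableT_comp measurable_snd measurable_snd).
Qed.

Lemma measurable_event_accuracy dY (Y : measurableType dY)
    (D : probability (X * Y)%type R) (C : set (O * Y)) (a : R) :
  measurable C -> measurable_event [set h | a%:E <= accuracy D C h].
Proof.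
move=> mC d W F mF.
rewrite -[X in measurable X]setTI; apply: emeasurable_fun_c_infty => //.
exact: (measurable_fun_section D (measurable_accurate mC mF)).
Qed.

End events.

Section randomized_maps.
Context (R : realType) (dZ dX dO : measure_display)
  (Z : measurableType dZ) (X : measurableType dX) (O : measurableType dO).
Implicit Types (D : probability Z R) (G : set (X -> O)).

Definition success m (A : randomized_map R Z X O m) D G : \bar R :=
  (iid D m \x seed_law A) [set p | G (output p.1 p.2)].

Lemma measurable_success m (A : randomized_map R Z X O m) G :
  measurable_event G ->
  measurable [set p : m.-tuple Z * seed A | G (output p.1 p.2)].
Proof. by move=> mG; apply: mG; exact: measurable_output. Qed.

Lemma measurable_fun_output m (A : randomized_map R Z X O m) (p : m.-tuple Z * seed A) :
  measurable_fun setT (output (r := A) p.1 p.2).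
Proof.
exact: (measurableT_comp (@measurable_output _ _ _ _ _ _ _ _ A)
  (@pair1_measurable _ _ (m.-tuple Z * seed A)%type X p)).
Qed.

(** Every output is a measurable function of the point, so the implication has to be checked for
    measurable [h] only. *)
Lemma success_le m (A : randomized_map R Z X O m) D G G' :
  measurable_event G -> measurable_event G' ->
  (forall h, measurable_fun setT h -> G h -> G' h) ->
  success A D G <= success A D G'.
Proof.
move=> mG mG' GG'; apply: le_measure.
- by rewrite inE; exact: measurable_success.
- by rewrite inE; exact: measurable_success.
- by move=> p; exact/GG'/measurable_fun_output.
Qed.

End randomized_maps.

(** * Two stages on disjoint blocks of the sample *)

Section sequential.
Context (R : realType) (dZ dX dO dS1 dS2 : measure_display)
  (Z : measurableType dZ) (X : measurableType dX) (O : measurableType dO)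
  (S1 : measurableType dS1) (S2 : measurableType dS2)
  (l1 : probability S1 R) (l2 : probability S2 R) (m1 m2 : nat)
  (F : (m1.-tuple Z * S1) * (m2.-tuple Z * S2) -> X -> O)
  (mF : measurable_fun setT (fun p => F p.1 p.2)).

Lemma measurable_seq_map : measurable_fun setT
  (fun p : (m1 + m2).-tuple Z * (S1 * S2) * X =>
    F ((ltake p.1.1, p.1.2.1), (rtake p.1.1, p.1.2.2)) p.2).
Proof.
have m1' := measurableT_comp measurable_fst (@measurable_fst _ _ ((m1 + m2).-tuple Z * (S1 * S2))%type X).
have m2' := measurableT_comp measurable_snd (@measurable_fst _ _ ((m1 + m2).-tuple Z * (S1 * S2))%type X).
have mg : measurable_fun setT (fun p : (m1 + m2).-tuple Z * (S1 * S2) * X =>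
    (((ltake p.1.1, p.1.2.1), (rtake p.1.1, p.1.2.2)), p.2)).
  apply: measurable_fun_pair => //.
  apply: measurable_fun_pair; apply: measurable_fun_pair.
  - exact: (measurableT_comp (@measurable_ltake _ Z m1 m2) m1').
  - exact: (measurableT_comp measurable_fst m2').
  - exact: (measurableT_comp (@measurable_rtake _ Z m1 m2) m1').
  - exact: (measurableT_comp measurable_snd m2').
exact: (measurableT_comp mF mg).
Qed.

Definition seq_map : randomized_map R Z X O (m1 + m2) :=
  @RandomizedMap R _ _ _ Z X O (m1 + m2) _ (S1 * S2)%type (l1 \x l2)
    (fun t r x => F ((ltake t, r.1), (rtake t, r.2)) x) measurable_seq_map.

Lemma success_seq_map (D : probability Z R) (G : set (X -> O)) :
  measurable_event G ->
  success seq_map D G =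
  ((iid D m1 \x l1) \x (iid D m2 \x l2)) [set w | G (F w)].
Proof. by move=> mG; rewrite -iid_seed_cat//; exact: mG. Qed.

End sequential.

Section measurable_events_tuple.
Context (dX dO : measure_display) (X : measurableType dX) (O : measurableType dO).

Lemma measurable_event_exists N (G : set (X -> O)) : measurable_event G ->
  measurable_event [set h : X -> N.-tuple O | exists i, G (fun x => tnth (h x) i)].
Proof.
move=> mG d W F mF.
rewrite (_ : [set w | _] = \bigcup_(i in [set: 'I_N]) [set w | G (fun x => tnth (F w x) i)]).
  apply: fin_bigcup_measurable; first exact: finite_finset.
  by move=> i _; apply: mG; exact: (measurableT_comp (measurable_tnth i) mF).
by apply/seteqP; split=> w /= [i]; exists i.
Qed.

End measurable_events_tuple.

(** * Padding the sample and independent repetition *)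

Section combinators.
Context (R : realType) (dZ dX dO : measure_display)
  (Z : measurableType dZ) (X : measurableType dX) (O : measurableType dO).

(** Learnability asks for a guarantee at every large sample size, while the constructions yield one
    size; surplus points are ignored. *)
Lemma discard_sample m m2 (f : randomized_map R Z X O m) :
  exists g : randomized_map R Z X O (m + m2), forall D G, measurable_event G ->
    success g D G = success f D G.
Proof.
pose F (w : (m.-tuple Z * seed f) * (m2.-tuple Z * unit)) := output (r := f) w.1.1 w.1.2.
have mF : measurable_fun setT (fun p => F p.1 p.2).
  have mg : measurable_fun setT (fun p : (m.-tuple Z * seed f) * (m2.-tuple Z * unit) * X =>
      (p.1.1, p.2)).
    by apply: measurable_fun_pair => //; exact: (measurableT_comp measurable_fst measurable_fst).
  exact: (measurableT_comp (@measurable_output _ _ _ _ _ _ _ _ f) mg).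
exists (seq_map (seed_law f) (\d_tt : probability unit R) mF) => D G mG.
rewrite success_seq_map//.
rewrite (_ : [set w | _] =
    [set p : m.-tuple Z * seed f | G (output p.1 p.2)] `*` setT); last first.
  by apply/seteqP; split=> [w Gw|w []].
pose P1 : probability (m.-tuple Z * seed f)%type R := iid D m \x seed_law f.
pose P2 : probability (m2.-tuple Z * unit)%type R := iid D m2 \x \d_tt.
transitivity (P1 [set p | G (output p.1 p.2)] * P2 setT).
  exact: (product_measure1E P1 P2 (measurable_success (A := f) mG) measurableT).
by rewrite probability_setT mule1.
Qed.

(** All [N] independent runs fail with probability at most [(1 - c) ^+ N]. The map returns every
    candidate and is fixed before [D], [G] and [c]. *)
Lemma repeat_map m (f : randomized_map R Z X O m) (N : nat) :
  exists n (g : randomized_map R Z X (N.-tuple O) n),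
  forall D G (c : R), measurable_event G -> c%:E <= success f D G ->
  (1 - (1 - c) ^+ N)%:E <=
    success g D [set h | exists i, G (fun x => tnth (h x) i)].
Proof.
elim: N => [|N [n [g IH]]].
  have m0 : measurable_fun setT (fun p : 0.-tuple Z * unit * X => [tuple] : 0.-tuple O).
    exact: measurable_cst.
  exists 0%N, (@RandomizedMap R _ _ _ Z X (0.-tuple O) 0 _ unit \d_tt
    (fun _ _ _ => [tuple]) m0) => D G c mG cf.
  by rewrite expr0 subrr; exact: measure_ge0.
pose W1 : measurableType _ := (m.-tuple Z * seed f)%type.
pose W2 : measurableType _ := (n.-tuple Z * seed g)%type.
pose F (w : W1 * W2) (x : X) : N.+1.-tuple O :=
  [tuple of output w.1.1 w.1.2 x :: output w.2.1 w.2.2 x].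
have mF : measurable_fun setT (fun p => F p.1 p.2).
  apply: measurable_cons.
    have mg : measurable_fun setT (fun p : W1 * W2 * X => (p.1.1, p.2)).
      by apply: measurable_fun_pair => //; exact: (measurableT_comp measurable_fst measurable_fst).
    exact: (measurableT_comp (@measurable_output _ _ _ _ _ _ _ _ f) mg).
  have mg : measurable_fun setT (fun p : W1 * W2 * X => (p.1.2, p.2)).
    by apply: measurable_fun_pair => //; exact: (measurableT_comp measurable_snd measurable_fst).
  exact: (measurableT_comp (@measurable_output _ _ _ _ _ _ _ _ g) mg).
exists (m + n)%N, (seq_map (seed_law f) (seed_law g) mF) => D G c mG cf.
rewrite success_seq_map; last exact: measurable_event_exists.
set A1 := [set p : W1 | G (output p.1 p.2)].
set A2 := [set p : W2 | exists i, G (fun x => tnth (output p.1 p.2 x) i)].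
have mA1 : measurable A1 by exact: measurable_success.
have mA2 : measurable A2 by exact: (measurable_success (A := g) (measurable_event_exists mG)).
pose P1 : probability W1 R := iid D m \x seed_law f.
pose P2 : probability W2 R := iid D n \x seed_law g.
pose P : probability (W1 * W2)%type R := P1 \x P2.
(* Failure means that the new run and all the earlier ones fail, which is a product event. *)
rewrite (_ : [set w | _] = ~` (~` A1 `*` ~` A2)); last first.
  apply/seteqP; split=> [w [i]|w /= nA].
    rewrite /F /=; case: (unliftP ord0 i) => [j|] -> Gi [] /= nA1 nA2.
      by apply: nA2; exists j; move: Gi; congr G; apply/funext => x; rewrite tnthS.
    by apply: nA1; move: Gi; congr G.
  have [wA1|wA1] := pselect (A1 w.1); first by exists ord0.
  have [[j Gj]|wA2] := pselect (A2 w.2); last by case: nA.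
  exists (lift ord0 j); move: Gj; congr G; apply/funext => x.
  by rewrite /F tnthS.
have mC : measurable (~` A1 `*` ~` A2) by apply: measurableX; exact: measurableC.
have -> : ((iid D m \x seed_law f) \x (iid D n \x seed_law g))
    (~` (~` A1 `*` ~` A2)) = 1 - P1 (~` A1) * P2 (~` A2).
  rewrite -(product_measure1E P1 P2)//; [|exact: measurableC..].
  exact: (probability_setC P mC).
have q1 : P1 (~` A1) <= (1 - c)%:E by rewrite probability_setC// EFinB leeB.
have q2 : P2 (~` A2) <= ((1 - c) ^+ N)%:E.
  rewrite probability_setC// leeBlDr; last exact: fin_num_measure.
  rewrite -leeBlDl// -EFinB. exact: IH.
rewrite EFinB leeB// exprS EFinM; exact: lee_pmul.
Qed.

End combinators.

(** * Concentration and validation *)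

Section concentration.
Context (R : realType) (d : measure_display) (Z : measurableType d)
  (D : probability Z R).

Definition hits (V : nat) (A : set Z) (v : V.-tuple Z) : nat :=
  \sum_(j < V) `[< A (tnth v j) >].

Lemma measurable_fun_hits V (A : set Z) : measurable A ->
  measurable_fun setT (fun v : V.-tuple Z => (hits A v)%:R : R).
Proof.
move=> mA.
rewrite (_ : (fun _ => _) = (fun v : V.-tuple Z => \sum_(j < V) \1_A (tnth v j)))%R.
  apply: measurable_sum => j; apply: (measurableT_comp _ (measurable_tnth j)).
  exact/measurable_indicP.
apply/funext => v; rewrite /hits natr_sum; apply: eq_bigr => j _.
by rewrite indicE; case: asboolP => [Az|nAz]; [rewrite mem_set|rewrite memNset].
Qed.

Lemma measurable_fun_tprod V (u : Z -> R) : measurable_fun setT u ->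
  measurable_fun setT (fun v : V.-tuple Z => \prod_(j < V) u (tnth v j))%R.
Proof.
move=> mu; apply: measurable_prod => j _.
exact: (measurableT_comp mu (measurable_tnth j)).
Qed.

(** Independence lets the integral factor one coordinate at a time; this bounds the moment
    generating function of [hits]. *)
Lemma integral_iid_prod_le V (u : Z -> R) (m : R) : measurable_fun setT u ->
  (forall z, 0 <= u z)%R -> \int[D]_z (u z)%:E <= m%:E ->
  \int[iid D V]_v (\prod_(j < V) u (tnth v j))%:E <= (m ^+ V)%:E.
Proof.
move=> mu u0 um.
have m0 : (0 <= m)%R.
  by rewrite -lee_fin; apply: le_trans um; apply: integral_ge0 => z _; rewrite lee_fin.
elim: V => [|V IH].
  rewrite (eq_integral (cst 1)) => [|v _]; last by rewrite big_ord0.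
  by rewrite integral_cst//= diracT mule1 expr0.
have mp := measurable_fun_tprod (V := V.+1) mu.
rewrite /= (ge0_integral_pushforward (@measurable_cons_sample _ Z V))//; last 2 first.
- exact/measurable_EFinP.
- by move=> v _; rewrite lee_fin prodr_ge0.
rewrite preimage_setT.
rewrite (fubini_tonelli1 (EFin \o (fun v : V.+1.-tuple Z => \prod_(j < V.+1) u (tnth v j))%R \o @cons_sample _ Z V)); last 2 first.
- apply: measurableT_comp; last exact: measurable_cons_sample.
  exact/measurable_EFinP.
- by move=> v /=; rewrite lee_fin prodr_ge0.
apply: (@le_trans _ _ (\int[D]_z ((m ^+ V)%:E * (u z)%:E))).
  apply: ge0_le_integral => //.
  - by move=> z _; apply: integral_ge0 => v _ /=; rewrite lee_fin prodr_ge0.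
  - apply: measurable_fun_fubini_tonelli_F => //=.
      apply: (@measurableT_comp _ _ _ _ _ _ (EFin \o (fun v : V.+1.-tuple Z => \prod_(j < V.+1) u (tnth v j))%R)).
        exact/measurable_EFinP.
      exact: measurable_cons_sample.
    by move=> v /=; rewrite lee_fin prodr_ge0.
  - by apply: measurable_funeM; exact/measurable_EFinP.
  - move=> z _; rewrite /fubini_F.
    rewrite (eq_integral (fun v => (u z)%:E * (\prod_(j < V) u (tnth v j))%:E)); last first.
      move=> v _ /=; rewrite -EFinM big_ord_recl; congr ((_ * _)%:E).
      by apply: eq_bigr => j _; rewrite tnthS.
    rewrite ge0_integralZl//; last 3 first.
    + by have mt := measurable_fun_tprod (V := V) mu; exact/measurable_EFinP.
    + by move=> v _; rewrite lee_fin prodr_ge0.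
    + by rewrite lee_fin.
    by rewrite muleC lee_wpmul2r// lee_fin.
rewrite ge0_integralZl//; last 3 first.
- exact/measurable_EFinP.
- by move=> z _; rewrite lee_fin.
- by rewrite lee_fin exprn_ge0.
by rewrite exprSr EFinM lee_wpmul2l// lee_fin exprn_ge0.
Qed.

(** Chernoff's method: Markov's inequality for the exponential of [s] times the number of hits. *)
Lemma count_tail V (A : set Z) (eta : R) : measurable A -> (0 < eta <= 1)%R ->
  iid D V [set v | ((fine (D A) + eta) * V%:R <= (hits A v)%:R)%R] <=
  (expR (- (eta ^+ 2 / 8 * V%:R)))%:E.
Proof.
move=> mA /andP[eta0 eta1]; set p := fine (D A).
have pE : D A = p%:E by rewrite /p fineK// fin_num_measure.
have p1 : (p <= 1)%R by rewrite -lee_fin -pE probability_le1.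
have p0 : (0 <= p)%R by rewrite -lee_fin -pE measure_ge0.
(* With [expR s - 1 <= s + 2 * s ^+ 2], the exponent per point is at most
   [2 * s ^+ 2 * p - s * eta], that is [eta ^+ 2 * p / 8 - eta ^+ 2 / 4], which is at most
   [- eta ^+ 2 / 8]. The function [u] is the exponential of [s] times the indicator of [A], in
   affine form so that its integral is immediate. *)
pose s := (eta / 4)%R.
pose u z : R := (1 + (expR s - 1) * \1_A z)%R.
have s0 : (0 < s)%R by rewrite /s; lra.
have es0 : (0 <= expR s - 1)%R by rewrite subr_ge0 -expR0 ler_expR ltW.
have es : (expR s - 1 <= s + 2 * s ^+ 2)%R.
  have h1 : (1 - s <= expR (- s))%R by exact: expR_ge1Dx.
  have h2 : (expR s * expR (- s) = 1)%R by rewrite expRN mulfV// gt_eqF// expR_gt0.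
  have h3 : (0 < expR s)%R := expR_gt0 s.
  have h4 : (expR s * (1 - s) <= 1)%R by rewrite -[X in (_ <= X)%R]h2 ler_wpM2l// ltW.
  have h5 : (1 <= (1 + s + 2 * s ^+ 2) * (1 - s))%R.
    have -> : ((1 + s + 2 * s ^+ 2) * (1 - s) = 1 + s ^+ 2 * (1 - 2 * s))%R by ring.
    by rewrite lerDl mulr_ge0// ?sqr_ge0// /s; lra.
  have h6 : (0 < 1 - s)%R by rewrite /s; lra.
  have := le_trans h4 h5; rewrite ler_pM2r//; lra.
have mu : measurable_fun setT u.
  by apply: measurable_funD => //; apply: measurable_funM => //; exact/measurable_indicP.
have u0 z : (0 <= u z)%R by rewrite addr_ge0// mulr_ge0.
have ui : \int[D]_z (u z)%:E <= (1 + (expR s - 1) * p)%:E.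
  rewrite (eq_integral (fun z => (cst 1 z) + (expR s - 1)%:E * (\1_A z)%:E)); last first.
    by move=> z _; rewrite /u EFinD EFinM.
  rewrite ge0_integralD//; last 2 first.
  - by move=> z _; rewrite -EFinM lee_fin mulr_ge0.
  - by apply: measurable_funeM; exact/measurable_EFinP/measurable_indicP.
  rewrite integral_cst_probability ge0_integralZl//; last first.
    exact/measurable_EFinP/measurable_indicP.
  rewrite [X in _ + _ * X](_ : _ = p%:E) -?EFinM -?EFinD//.
  by rewrite -pE integral_indic// setIT.
have uhits v : (\prod_(j < V) u (tnth v j) = expR (s * (hits A v)%:R))%R.
  rewrite /hits natr_sum mulr_sumr expR_sum; apply: eq_bigr => j _.
  rewrite /u indicE; case: asboolP => [Az|nAz].
    by rewrite mem_set// !mulr1 addrC subrK.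
  by rewrite memNset// !mulr0 addr0 expR0.
set B := [set v | _].
have mB : measurable B by apply: measurable_set_ge; exact: measurable_fun_hits.
pose t := (s * ((p + eta) * V%:R))%R.
(* Markov's inequality: on [B] the product of the [u] is at least [expR t]. *)
have step : (expR t)%:E * iid D V B <= ((1 + (expR s - 1) * p) ^+ V)%:E.
  apply: le_trans (@integral_iid_prod_le V u _ mu u0 ui).
  rewrite (_ : iid D V B = \int[iid D V]_v (\1_B v)%:E); last by rewrite integral_indic// setIT.
  rewrite -ge0_integralZl//; last 2 first.
  all: try (by apply/measurable_EFinP; exact/measurable_indicP).
  all: try (by rewrite lee_fin expR_ge0).
  apply: ge0_le_integral => //.
  - by apply: measurable_funeM; exact/measurable_EFinP/measurable_indicP.
  - by have mt := measurable_fun_tprod (V := V) mu; exact/measurable_EFinP.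
  - move=> v _; rewrite uhits -EFinM lee_fin indicE.
    case: (boolP (v \in B)) => [|_]; last by rewrite mulr0 expR_ge0.
    by rewrite inE /B /= => vB; rewrite mulr1 ler_expR ler_wpM2l// ltW.
have pow : ((1 + (expR s - 1) * p) ^+ V <= expR ((s + 2 * s ^+ 2) * p * V%:R))%R.
  rewrite expRM_natr lerXn2r// ?nnegrE ?expR_ge0//.
    by rewrite addr_ge0// mulr_ge0.
  by apply: le_trans (expR_ge1Dx _); rewrite lerD2l ler_wpM2r.
rewrite -(@lee_pmul2l _ (expR t)%:E)// ?lte_fin ?expR_gt0//.
apply: (le_trans step); rewrite -EFinM lee_fin; apply: (le_trans pow).
rewrite -expRD ler_expR /t /s.
have V0 : (0 <= V%:R :> R)%R by [].
have : (0 <= V%:R * (eta ^+ 2 * (1 - p)))%R.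
  by apply: mulr_ge0 => //; apply: mulr_ge0; [exact: sqr_ge0|rewrite subr_ge0].
nra.
Qed.
End concentration.

Section uniform_concentration.
Context (R : realType) (d : measure_display) (Z : measurableType d).

Lemma hitsC V (A : set Z) (v : V.-tuple Z) : (hits A v + hits (~` A) v = V)%N.
Proof.
rewrite /hits -big_split /= -[RHS]card_ord -sum1_card; apply: eq_bigr => j _.
by case: asboolP => Aj; case: asboolP.
Qed.

Definition deviates (D : probability Z R) V (eta : R) (A : set Z) : set (V.-tuple Z) :=
  [set v | (eta * V%:R < `|(hits A v)%:R - fine (D A) * V%:R|)%R].

Lemma measurable_deviates (D : probability Z R) V (eta : R) (A : set Z) :
  measurable A -> measurable (deviates D (V := V) eta A).
Proof.
move=> mA.
have mf : measurable_fun setT (fun v : V.-tuple Z =>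
    `|(hits A v)%:R - fine (D A) * V%:R|)%R.
  by apply: measurableT_comp => //; apply: measurable_funB => //; exact: measurable_fun_hits.
exact: measurable_set_gt.
Qed.

(** The lower tail for [A] is the upper tail for its complement, since their hits add up to [V]. *)
Lemma deviates_le (D : probability Z R) V (eta : R) (A : set Z) :
  measurable A -> (0 < eta <= 1)%R ->
  iid D V (deviates D eta A) <= (2 * expR (- (eta ^+ 2 / 8 * V%:R)))%:E.
Proof.
move=> mA eta01; set e := expR _.
have mA' := measurableC mA.
pose U B : set (V.-tuple Z) := [set v | ((fine (D B) + eta) * V%:R <= (hits B v)%:R)%R].
have mU B : measurable B -> measurable (U B) 
  by move=> mB; apply: measurable_set_ge; exact: measurable_fun_hits.
have DC : fine (D (~` A)) = (1 - fine (D A))%R.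
  rewrite probability_setC// -[D A in LHS]fineK ?fin_num_measure//.
apply: (@le_trans _ _ (iid D V (U A `|` U (~` A)))).
  apply: le_measure; rewrite ?inE; [exact: measurable_deviates|exact: measurableU (mU _ mA) (mU _ mA')|].
  move=> v; rewrite /deviates /U /= DC.
  have : ((hits A v)%:R + (hits (~` A) v)%:R = V%:R :> R)%R by rewrite -natrD hitsC.
  set h := ((hits A v)%:R)%R; set h' := ((hits (~` A) v)%:R)%R; move=> hh.
  by rewrite lter_normr => /orP[] hlt; [left|right]; lra.
apply: (le_trans (measureU2 (iid D V) (mU _ mA) (mU _ mA'))).
by rewrite mulr2n mulrDl mul1r EFinD leeD// count_tail.
Qed.

(** A union bound over the [N] sets. The sample size is chosen before [D] and the sets, so it serves
    candidates that are themselves random. *)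
Lemma concentration (eta delta : R) (N : nat) : (0 < eta)%R -> (0 < delta)%R ->
  exists V : nat, forall (D : probability Z R) (A : 'I_N -> set Z),
  (forall i, measurable (A i)) ->
  (1 - delta)%:E <= iid D V.+1 (~` \bigcup_(i in [set: 'I_N]) deviates D eta (A i)).
Proof.
(* The tail bound wants a deviation of at most 1, hence the cap. The bound [expR (- x) <= x^-1]
   turns [2 * N * expR (- (e ^+ 2 / 8 * V.+1))] into [16 * N / (e ^+ 2 * V.+1)], which dictates [V];
   the successor keeps the sample nonempty. *)
move=> eta0 delta0; pose e := Num.min eta 1%R.
have e01 : (0 < e <= 1)%R by rewrite lt_min eta0 ltr01 ge_min lexx orbT.
pose V := Num.bound (16 * N%:R / (delta * e ^+ 2) : R).
exists V => D A mA.
have e0 : (0 < e)%R by case/andP: e01.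
have mU : measurable (\bigcup_(i in [set: 'I_N]) (deviates D eta (A i) : set (V.+1.-tuple Z))).
  apply: fin_bigcup_measurable; first exact: finite_finset.
  by move=> i _; exact: measurable_deviates.
have Vge : (N%:R * (2 * expR (- (e ^+ 2 / 8 * V.+1%:R))) <= delta)%R.
  have x0 : (0 < e ^+ 2 / 8 * V.+1%:R)%R by rewrite mulr_gt0// divr_gt0// exprn_gt0.
  have h1 : (16 * N%:R / (delta * e ^+ 2) < V.+1%:R)%R.
    apply: (@lt_trans _ _ V%:R); last by rewrite ltr_nat.
    by apply: archi_boundP; rewrite !mulr_ge0// invr_ge0 mulr_ge0 ?sqr_ge0// ltW.
  have h2 : (expR (- (e ^+ 2 / 8 * V.+1%:R)) <= (e ^+ 2 / 8 * V.+1%:R)^-1)%R.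
    rewrite expRN lef_pV2 ?posrE ?expR_gt0//.
    by apply: le_trans (expR_ge1Dx _); rewrite lerDr.
  apply: (@le_trans _ _ (N%:R * (2 * (e ^+ 2 / 8 * V.+1%:R)^-1)))%R.
    by rewrite ler_wpM2l// ler_wpM2l.
  rewrite mulrA ler_pdivrMr// -ler_pdivrMl//.
  move: h1; rewrite ltr_pdivrMr ?mulr_gt0 ?exprn_gt0// => h1.
  rewrite ler_pdivrMl//; lra.
rewrite probability_setC// EFinB leeB//.
apply: le_trans _ (_ : (N%:R * (2 * expR (- (e ^+ 2 / 8 * V.+1%:R))))%:E <= _); last by rewrite lee_fin.
(* Padding by the empty set gives a sequence indexed by [nat], the form that Boole's inequality
   takes. *)
pose A' (i : nat) : set (V.+1.-tuple Z) := if insub i is Some j then deviates D eta (A j) else set0.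
have mA' i : measurable (A' i).
  by rewrite /A'; case: insubP => // j _ _; exact: measurable_deviates.
rewrite (_ : \bigcup_(i in _) _ = \big[setU/set0]_(i < N) A' i); last first.
  rewrite -bigcup_mkord; apply/seteqP; split=> [v [i _ vi]|v [i iN]].
    by exists (val i); rewrite /A' ?valK//=.
  by rewrite /A'; case: insubP => // j _ _ vj; exists j.
apply: (le_trans (Boole_inequality (iid D V.+1) _)); first by move=> i _; exact: mA'.
apply: (@le_trans _ _ (\sum_(i < N) (2 * expR (- (e ^+ 2 / 8 * V.+1%:R)))%:E)).
  apply: lee_sum => i _; rewrite /A' valK.
  apply: le_trans (deviates_le D V.+1 (mA i) e01).
  apply: le_measure; rewrite ?inE; [exact: measurable_deviates..|].
  move=> v; rewrite /deviates /=; apply: le_lt_trans.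
  by rewrite ler_wpM2r// ge_min lexx.
by rewrite sumEFin sumr_const card_ord lee_fin -[X in (X <= _)%R]mulr_natl.
Qed.

End uniform_concentration.

Section validation.
Context (R : realType) (dX dY dO : measure_display)
  (X : measurableType dX) (Y : measurableType dY) (O : measurableType dO)
  (C : set (O * Y)) (mC : measurable C).

(* g outputs the candidate of f with the most hits on a fresh sample. *)
Lemma validate N n (f : randomized_map R (X * Y)%type X (N.+1.-tuple O) n)
    (eta delta : R) : (0 < eta)%R -> (0 < delta <= 1)%R ->
  exists n' (g : randomized_map R (X * Y)%type X O n'),
  forall (D : probability (X * Y)%type R) (a c : R),
  c%:E <= success f D
    [set h | exists i, a%:E <= accuracy D C (fun x => tnth (h x) i)] ->
  (c * (1 - delta))%:E <= success g D [set h | (a - eta)%:E <= accuracy D C h].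
Proof.
move=> eta0 /andP[delta0 delta1].
have e20 : (0 < eta / 2)%R by rewrite divr_gt0.
(* Half of [eta] is lost on the best candidate and half on the selected one. *)
have [V conc] := @concentration R _ (X * Y)%type (eta / 2) delta N.+1 e20 delta0.
pose Z : measurableType _ := (X * Y)%type.
pose W1 : measurableType _ := (n.-tuple Z * seed f)%type.
pose W2 : measurableType _ := (V.+1.-tuple Z * unit)%type.
pose cand (w : W1) i (x : X) : O := tnth (output w.1 w.2 x) i.
have mcand i : measurable_fun setT (fun p : W1 * X => cand p.1 i p.2).
  exact: (measurableT_comp (measurable_tnth i) (@measurable_output _ _ _ _ _ _ _ _ f)).
have mpair i := @measurable_accurate _ _ X O _ Y C _ W1 (cand^~ i) mC (mcand i).
pose right (w : W1) i := [set z : Z | C (cand w i z.1, z.2)].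
have mright w i : measurable (right w i).
  exact: (measurable_section1 w (mpair i)).
pose I : finType := ('I_N.+1 * 'I_V.+1)%type.
(* The choice depends on the data only through this finite table of correct predictions, so its
   measurability is a finite case distinction. *)
pose table (w : W1 * W2) : {ffun I -> bool} :=
  [ffun ij => `[< right w.1 ij.1 (tnth w.2.1 ij.2) >]].
pose best (p : {ffun I -> bool}) : 'I_N.+1 :=
  [arg max_(i > ord0) (\sum_(j < V.+1) p (i, j))%N]%N.
pose F (w : W1 * W2) (x : X) : O := cand w.1 (best (table w)) x.
have mtable p : measurable [set w | table w = p].
  apply: (@measurable_pattern _ (W1 * W2)%type I
    (fun ij w => right w.1 ij.1 (tnth w.2.1 ij.2))) => -[i j] /=.
  apply: (measurable_preim (f := fun w : W1 * W2 => (w.1, tnth w.2.1 j)) _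
    (mpair i)).
  apply: measurable_fun_pair => //.
  apply: (measurableT_comp (measurable_tnth j)).
  exact: (measurableT_comp measurable_fst measurable_snd).
have mF : measurable_fun setT (fun p => F p.1 p.2).
  apply: (@measurable_fun_finite_case _ _ (W1 * W2 * X)%type _ _
    (fun p => best (table p.1)) (fun i p => cand p.1.1 i p.2)).
    move=> i; apply: (measurable_preim (f := fst) (B := [set w | best (table w) = i])) => //.
    rewrite (_ : [set w | _] = \bigcup_(p in [set p | best p = i]) [set w | table w = p]).
      by apply: fin_bigcup_measurable => //; exact: finite_finset.
    by apply/seteqP; split=> [w wi|w [p /= <- ->]//]; exists (table w).
  move=> i; have mg : measurable_fun setT (fun p : W1 * W2 * X => (p.1.1, p.2)).
    by apply: measurable_fun_pair => //; exact: (measurableT_comp measurable_fst measurable_fst).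
  exact: (measurableT_comp (mcand i) mg).
exists (n + V.+1)%N, (seq_map (seed_law f) (\d_tt : probability unit R) mF) => D a c cf.
have mG := measurable_event_accuracy D (a - eta) mC.
rewrite success_seq_map//.
pose P1 : probability W1 R := iid D n \x seed_law f.
pose P2 : probability W2 R := iid D V.+1 \x \d_tt.
apply: (@product_measure1_ge _ _ _ _ R P1 P2 [set p : W1 | exists i, a%:E <= accuracy D C (cand p i)]).
- exact: (measurable_success (A := f) (measurable_event_exists (measurable_event_accuracy D a mC))).
- exact: mG.
- by rewrite subr_ge0.
- exact: cf.
(* Once the first stage is fixed, so are the candidates, and concentration applies to them on the
   fresh block. *)
move=> w [i0 hi0].
apply: (le_trans (conc D (right w) (mright w))).
set B := ~` _.
have mB : measurable B.
  apply: measurableC; apply: fin_bigcup_measurable; first exact: finite_finset.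
  by move=> i _; exact: measurable_deviates.
have -> : iid D V.+1 B = P2 (B `*` setT).
  transitivity (iid D V.+1 B * (\d_tt : probability unit R) setT).
    by rewrite -[LHS]mule1; congr (_ * _); exact/esym/(@probability_setT _ _ _ (\d_tt : probability unit R)).
  exact/esym/(product_measure1E (iid D V.+1) (\d_tt : probability unit R) mB measurableT).
apply: le_measure; rewrite ?inE.
- exact: measurableX.
- exact: (measurable_section1 w (mG _ _ _ mF)).
move=> [v u] [/= Bv _]; rewrite /F.
set p := table (w, (v, u)).
have hitsE i : (\sum_(j < V.+1) p (i, j))%N = hits (right w i) v.
  by apply: eq_bigr => j _; rewrite ffunE.
have fineE i : accuracy D C (cand w i) = (fine (D (right w i)))%:E.
  by rewrite fineK// fin_num_measure.
have near i : (`|(hits (right w i) v)%:R - fine (D (right w i)) * V.+1%:R| <= eta / 2 * V.+1%:R)%R.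
  by rewrite leNgt; apply/negP => h; apply: Bv; exists i.
have hbest : (hits (right w i0) v <= hits (right w (best p)) v)%N.
  by rewrite -!hitsE /best; case: arg_maxnP => // i _; exact.
move: hi0; rewrite /= !fineE !lee_fin => hi0.
have V0 : (0 < V.+1%:R :> R)%R by [].
rewrite -(ler_pM2r V0).
have h1 := near i0; have h2 := near (best p).
move: hbest h1 h2; rewrite -(ler_nat R) !ler_norml => hb /andP[h1 _] /andP[_ h2].
(* The selected candidate is within [eta / 2] of its hit rate, which is at least that of [i0],
   itself within [eta / 2] of an accuracy at least [a]. *)
have : (a * V.+1%:R <= fine (D (right w i0)) * V.+1%:R)%R by rewrite ler_pM2r.
lra.
Qed.

End validation.

(** * A single algorithm for all parameters *)

Section diagonal.
Context (R : realType) (dX dY dO : measure_display)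
  (X : measurableType dX) (Y : measurableType dY) (O : measurableType dO)
  (C : set (O * Y)) (mC : measurable C).

(* On samples of size n, run the best map that needs at most n points. *)
Lemma learnable_of_fixed (A0 : algorithm R (X * Y)%type X O)
    (K : set (probability (X * Y)%type R)) (T : R -> R) :
  (forall e e', e' <= e -> T e <= T e')%R ->
  (forall e, (0 < e)%R -> exists n (f : randomized_map R (X * Y)%type X O n),
    forall D, K D ->
      (1 - e)%:E <= success f D [set h | (T e)%:E <= accuracy D C h]) ->
  exists (A : algorithm R (X * Y)%type X O) (m : R -> nat), forall D, K D ->
    forall e, (0 < e)%R -> forall n, (m e <= n)%N ->
      (1 - e)%:E <= success (A n) D [set h | (T e)%:E <= accuracy D C h].
Proof.
move=> Tmono fixed.
pose e_ (j : nat) : R := (j.+1%:R^-1)%R.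
pose good j n (f : randomized_map R (X * Y)%type X O n) := forall D, K D ->
  (1 - e_ j)%:E <= success f D [set h | (T (e_ j))%:E <= accuracy D C h].
have [s sP] : {s : nat -> nat & forall j, exists f, good j (s j) f}.
  apply: (@boolp.choice _ _ (fun j n => exists f, good j n f)) => j.
  have [|n [f fP]] := fixed (e_ j); first by rewrite invr_gt0.
  by exists n, f.
(* Take the largest [j] with [j <= n] and [s j <= n]; the bound [j <= n] makes a maximum exist. If
   there is none, the claim is vacuous and [A0] fills in. *)
have best n : exists A : randomized_map R (X * Y)%type X O n,
    forall j, (j <= n)%N -> (s j <= n)%N -> exists2 j', (j <= j')%N & good j' n A.
  have [ex|nex] := pselect (exists j, (j <= n)%N && (s j <= n)%N); last first.
    by exists (A0 n) => j jn sn; case: nex; exists j; rewrite jn sn.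
  have bd j : (j <= n)%N && (s j <= n)%N -> (j <= n)%N by case/andP.
  have [j /andP[jn sn] jmax] := ex_maxnP ex bd.
  have [f fP] := sP j.
  have [g gP] := discard_sample (n - s j) f.
  rewrite subnKC// in g gP *.
  exists g => i i_n s_in; exists j; first by apply: jmax; rewrite i_n.
  move=> D KD; rewrite gP; first exact: fP.
  exact: measurable_event_accuracy.
exists (fun n => projT1 (cid (best n))).
(* From this size on, the index [Num.bound e^-1] is eligible, so the index in use is at least that
   and its precision [e_ j] is at most [e]. *)
exists (fun e => maxn (Num.bound e^-1) (s (Num.bound e^-1))) => D KD e e0 n.
rewrite geq_max => /andP[bn sn].
case: (cid (best n)) => A AP /=; have [j bj Aj] := AP _ bn sn.
have eje : (e_ j <= e)%R.
  rewrite -[e]invrK lef_pV2 ?posrE ?invr_gt0//.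
  apply/ltW/(lt_le_trans (archi_boundP _)); first by rewrite invr_ge0 ltW.
  by rewrite ler_nat ltnW.
apply: le_trans (le_trans (Aj D KD) _); first by rewrite lee_fin lerB.
apply: success_le; [exact: measurable_event_accuracy..|].
by move=> h _ /=; apply: le_trans; rewrite lee_fin; exact: Tmono.
Qed.

End diagonal.

(** * Labels with many votes *)

Section plurality.
Context (dY : measure_display) (Y : measurableType dY)
  (diagY : measurable [set p : Y * Y | p.1 = p.2]).

Definition votes L (t : L.-tuple Y) (y : Y) : nat :=
  \sum_(i < L) `[< tnth t i = y >].

(** [K] labels with at least [c.+1] votes each would use more than the [K * c] votes available, so
    [K.-1] places suffice. *)
Lemma heavy_labels K c : (0 < K)%N ->
  exists l : (K * c).-tuple Y -> K.-1.-tuple Y, measurable_fun setT l /\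
    forall t y, (c < votes t y)%N -> y \in l t.
Proof.
move=> K0; set L := (K * c)%N.
pose I : finType := ('I_L * 'I_L)%type.
pose same (t : L.-tuple Y) : {ffun I -> bool} := [ffun ij => `[< tnth t ij.1 = tnth t ij.2 >]].
(* Each heavy label is represented by the first position where it occurs. Only the equality pattern
   of the votes enters, so finitely many cases arise; [point] fills the spare places of the list. *)
pose heavy (p : {ffun I -> bool}) : seq 'I_L :=
  [seq i <- enum 'I_L | (c < \sum_(j < L) p (i, j))%N
    && [forall j : 'I_L, (j < i)%N ==> ~~ p (i, j)]].
pose chosen (p : {ffun I -> bool}) (t : L.-tuple Y) : K.-1.-tuple Y :=
  [tuple (if onth (heavy p) m is Some i then tnth t i else point) | m < K.-1].
have size_heavy t : (size (heavy (same t)) <= K.-1)%N.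
  set hs := heavy (same t).
  have uhs : uniq hs by rewrite filter_uniq// enum_uniq.
  have le1 : (\sum_(i <- hs) c.+1 <= \sum_(i <- hs) \sum_(j < L) same t (i, j))%N.
    by rewrite big_seq [in leqRHS]big_seq; apply: leq_sum => i; rewrite mem_filter => /andP[/andP[]].
  (* Distinct representatives carry distinct labels, so each position votes for at most one of
     them. *)
  have le2 : (\sum_(i <- hs) \sum_(j < L) same t (i, j) <= L)%N.
    rewrite exchange_big /= -[leqRHS]card_ord -sum1_card; apply: leq_sum => j _.
    have uniq_rep i i' : i \in hs -> i' \in hs -> same t (i, j) -> same t (i', j) -> i = i'.
      rewrite !mem_filter => /andP[/andP[_ /forallP fi] _] /andP[/andP[_ /forallP fi'] _].
      rewrite !ffunE /= => /asboolP tij /asboolP ti'j.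
      apply/val_inj/eqP; rewrite eqn_leq; apply/andP; split; rewrite leqNgt; apply/negP => ltii.
        by have := implyP (fi i') ltii; rewrite ffunE /= => /asboolP; apply; rewrite tij.
      by have := implyP (fi' i) ltii; rewrite ffunE /= => /asboolP; apply; rewrite tij.
    have [/hasP[i ihs tij]|/hasPn none] := boolP (has (fun i => same t (i, j)) hs).
      rewrite (bigD1_seq i)//= big_seq_cond big1 ?addn0 ?leq_b1// => i' /andP[i'hs i'i].
      apply/eqP; rewrite eqb0; apply/negP => ti'j.
      by move/eqP: i'i; apply; exact: uniq_rep ti'j tij.
    by rewrite big_seq big1// => i /none /negbTE ->.
  have := leq_trans le1 le2; rewrite big_const_seq count_predT iter_addn_0 /L.
  move=> le3; rewrite -ltnS prednK// ltnNge; apply/negP => Khs.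
  have := leq_trans (leq_mul (leqnn c.+1) Khs) le3.
  by rewrite mulSn mulnC; lia.
exists (fun t => chosen (same t) t); split.
  apply: (@measurable_fun_finite_case _ _ (L.-tuple Y) _ _ same chosen).
    move=> p; apply: (@measurable_pattern _ (L.-tuple Y) I
      (fun ij t => tnth t ij.1 = tnth t ij.2)) => -[i j] /=.
    apply: (measurable_preim (f := fun t : L.-tuple Y => (tnth t i, tnth t j)) _ diagY).
    by apply: measurable_fun_pair; exact: measurable_tnth.
  move=> p; apply: measurable_mktuple => m.
  by case: (onth _ _) => [i|]; [exact: measurable_tnth|exact: measurable_cst].
move=> t y cy.
have [i0 ti0] : exists i, `[< tnth t i = y >].
  apply/existsP; rewrite -[X in is_true X]negbK; apply/negP => /existsPn nex.
  by move: cy; rewrite /votes big1// => i _; apply/eqP; rewrite eqb0; exact: nex.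
have [i /asboolP tiy imin] := @arg_minnP _ i0 (fun i => `[< tnth t i = y >]) (fun i => val i) ti0.
have ih : i \in heavy (same t).
  rewrite mem_filter mem_enum andbT; apply/andP; split.
    rewrite (eq_bigr (fun j => `[< tnth t j = y >] : nat))// => j _.
    by rewrite ffunE /= tiy; congr nat_of_bool; apply/asboolP/asboolP.
  apply/forallP => j; apply/implyP => ji; rewrite ffunE /=; apply/asboolPn => tij.
  have tjy : `[< tnth t j = y >] by apply/asboolP; rewrite -tij.
  by have := imin j tjy; rewrite leqNgt ji.
have im : (index i (heavy (same t)) < K.-1)%N.
  by apply: leq_trans (size_heavy t); rewrite index_mem.
apply/tnthP; exists (Ordinal im).
by rewrite tnth_mktuple /= onthE (nth_map i) ?index_mem// nth_index.
Qed.

End plurality.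

(** * Multiplicative weights *)

Section reweighting.
Context (R : realType) (d : measure_display) (Z : measurableType d).

Lemma density_probability (D : probability Z R) (f : Z -> R) :
  measurable_fun setT f -> (forall z, 0 <= f z)%R -> \int[D]_z (f z)%:E = 1 ->
  exists P : probability Z R, forall A, P A = \int[D]_(z in A) (f z)%:E.
Proof.
move=> mf f0 f1; pose mu A := \int[D]_(z in A) (f z)%:E.
have mu0 : mu set0 = 0 by rewrite /mu integral_set0.
have mu_ge0 A : 0 <= mu A by apply: integral_ge0 => z _; rewrite lee_fin.
have mu_sigma : semi_sigma_additive mu.
  move=> F mF tF mUF; rewrite /mu ge0_integral_bigcup//.
  - by apply: is_cvg_ereal_nneg_natsum_cond => n _ _; exact: mu_ge0.
  - by apply/measurable_EFinP; exact: measurable_funTS.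
  - by move=> z _; rewrite lee_fin.
pose M : {measure set Z -> \bar R} := HB.pack mu (isMeasure.Build _ _ _ mu mu0 mu_ge0 mu_sigma).
pose P : probability Z R := HB.pack mu (Measure.class M) (Measure_isProbability.Build _ _ _ M f1).
by exists P.
Qed.

Lemma product_measure1_dominated d' (S : measurableType d')
    (P D : probability Z R) (Q E : probability S R) (a b : R) :
  (0 <= a)%R -> (0 <= b)%R ->
  (forall A, measurable A -> P A <= a%:E * D A) ->
  (forall A, measurable A -> Q A <= b%:E * E A) ->
  forall A, measurable A -> (P \x Q) A <= (a * b)%:E * (D \x E) A.
Proof.
move=> a0 b0 Pa Qb A mA; rewrite !product_measure1_section.
have mE := measurable_fun_section E mA.
apply: (@le_trans _ _ (\int[P]_x (b%:E * E [set y | A (x, y)]))).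
  apply: ge0_le_integral => //.
  - exact: measurable_fun_section mA.
  - exact: measurable_funeM.
  - by move=> x _; apply: Qb; exact: measurable_section1.
apply: (@le_trans _ _ (\int[mscale (NngNum a0) D]_x (b%:E * E [set y | A (x, y)]))).
  apply: ge0_le_measure_integral => //.
  - by move=> x; rewrite mule_ge0.
  - exact: measurable_funeM.
rewrite ge0_integral_mscale//; last 2 first.
- exact: measurable_funeM.
- by move=> x _; rewrite mule_ge0.
by rewrite ge0_integralZl// EFinM muleA.
Qed.

End reweighting.

(** Read backwards: an event likely for samples from [P] keeps at least a fraction [a ^- m] of its
    probability for samples from [D]. *)
Lemma iid_dominated (R : realType) d (Z : measurableType d)
    (P D : probability Z R) (a : R) :
  (0 <= a)%R -> (forall A, measurable A -> P A <= a%:E * D A) ->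
  forall m A, measurable A -> iid P m A <= (a ^+ m)%:E * iid D m A.
Proof.
move=> a0 Pa; elim=> [|m IH] A mA; first by rewrite expr0 mul1e.
have mA' := measurable_preim (@measurable_cons_sample _ Z m) mA.
rewrite exprS.
exact: (product_measure1_dominated a0 (exprn_ge0 m a0) Pa IH mA').
Qed.

Lemma exists_expr_le (R : realType) (x e : R) : (0 <= x < 1)%R -> (0 < e)%R ->
  exists N : nat, (x ^+ N <= e)%R.
Proof.
move=> /andP[x0 x1] e0.
have : (`|x| < 1)%R by rewrite ger0_norm.
move/cvg_expr/cvgr0Pnorm_lt => /(_ e e0) [N _ NP].
by exists N; have := NP N (leqnn N); rewrite /= ger0_norm ?exprn_ge0// => /ltW.
Qed.

Lemma exprn_bernoulli (R : realDomainType) (x : R) n : (0 <= x)%R ->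
  (1 + n%:R * x <= (1 + x) ^+ n)%R.
Proof.
move=> x0; elim: n => [|n IH]; first by rewrite mul0r addr0 expr0.
rewrite exprS; apply: le_trans (ler_wpM2l _ IH); last by rewrite addr_ge0.
rewrite -natr1; have n0 : (0 <= n%:R :> R)%R by [].
have := mulr_ge0 n0 (sqr_ge0 x); nra.
Qed.

(** For small [s = 1 - beta], the power is about [1 - s * K * gamma], which is below [1 - s].
    Explicitly, write [K * gamma = 1 + 2 * u] and [s = u / (1 + 2 * u)]. Bernoulli bounds the power
    by [1 / (1 + u)], while [(1 - s) * (1 + u) = (1 + u) ^+ 2 / (1 + 2 * u)] exceeds 1. *)
Lemma boosting_rate (R : realFieldType) (K : nat) (gamma : R) :
  (0 <= gamma <= 1)%R -> (1 < K%:R * gamma)%R ->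
  exists2 beta : R, (0 < beta < 1)%R & ((1 - (1 - beta) * gamma) ^+ K < beta)%R.
Proof.
move=> /andP[g0 g1] Kg; pose u := ((K%:R * gamma - 1) / 2)%R.
have u0 : (0 < u)%R by rewrite /u; lra.
have Kg2 : (K%:R * gamma = 1 + 2 * u)%R by rewrite /u; field.
have u1 : (0 < 1 + 2 * u)%R by lra.
pose s := (u / (1 + 2 * u))%R.
have s0 : (0 < s)%R by rewrite divr_gt0.
have s1 : (s < 1)%R by rewrite ltr_pdivrMr//; lra.
have su : (s * (1 + 2 * u) = u)%R by rewrite /s divfK// gt_eqF.
exists (1 - s)%R; first by lra.
rewrite (_ : 1 - (1 - s) = s)%R; last by ring.
have x0 : (0 <= s * gamma)%R by rewrite mulr_ge0// ltW.
have x1 : (s * gamma <= 1)%R by rewrite mulr_ile1// ltW.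
have h1 : ((1 - s * gamma) ^+ K * (1 + u) <= 1)%R.
  apply: (@le_trans _ _ ((1 - s * gamma) ^+ K * (1 + s * gamma) ^+ K)%R).
    rewrite ler_wpM2l ?exprn_ge0 ?subr_ge0//; apply: le_trans (exprn_bernoulli K x0).
    by rewrite lerD2l mulrCA Kg2 su.
  rewrite -exprMn exprn_ile1//; nra.
have h2 : (1 < (1 - s) * (1 + u))%R.
  rewrite -(ltr_pM2r u1) mul1r; nra.
have u2 : (0 < 1 + u)%R by lra.
by rewrite -(ltr_pM2r u2); exact: le_lt_trans h2.
Qed.

Section realizability.
Context (R : realType) (dX dY : measure_display)
  (X : measurableType dX) (Y : measurableType dY)
  (diagY : measurable [set p : Y * Y | p.1 = p.2]).

Lemma measurable_fun_agree d (T : measurableType d) (f g : T -> Y) :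
  measurable_fun setT f -> measurable_fun setT g -> measurable [set t | f t = g t].
Proof.
move=> mf mg; apply: (measurable_preim (f := fun t => (f t, g t)) _ diagY).
exact: measurable_fun_pair.
Qed.

(** A hypothesis with error below [e / a] under [D] has error at most [e] under [P]. This lets the
    weak learner be invoked on reweighted laws. *)
Lemma realizable_dominated (H : set (X -> Y))
    (measH : forall h : X -> Y, H h -> measurable_fun setT h)
    (P D : probability (X * Y)%type R) (a : R) : (0 < a)%R ->
  (forall A, measurable A -> P A <= a%:E * D A) ->
  realizable H D -> realizable H P.
Proof.
move=> a0 Pa HD; apply/eqP; rewrite eq_le; apply/andP; split; last first.
  by apply: le_ereal_inf_tmp => _ [h _ <-]; exact: measure_ge0.
apply/lee_addgt0Pr => e e0; rewrite add0e.
have : ereal_inf [set D [set z | h z.1 <> z.2] | h in H] < (e / a)%:E.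
  by rewrite HD lte_fin divr_gt0.
move=> /ereal_inf_lt [_ [h Hh <-]] De.
apply: (@le_trans _ _ (P [set z | h z.1 <> z.2])); first by apply: ereal_inf_lbound; exists h.
have mE : measurable [set z : X * Y | h z.1 <> z.2].
  apply: measurableC; apply: measurable_fun_agree => //.
  exact: (measurableT_comp (measH h Hh) measurable_fst).
apply: (le_trans (Pa _ mE)); rewrite -lee_pdivlMl// muleC -EFinM.
exact: ltW.
Qed.

End realizability.

Section boosting.
Context (R : realType) (dX dY : measure_display)
  (X : measurableType dX) (Y : measurableType dY)
  (diagY : measurable [set p : Y * Y | p.1 = p.2]) (H : set (X -> Y))
  (measH : forall h : X -> Y, H h -> measurable_fun setT h).
Context (beta gamma : R) (beta01 : (0 < beta < 1)%R) (gamma01 : (0 <= gamma <= 1)%R).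

Let Z : measurableType _ := (X * Y)%type.
Let beta0 : (0 < beta)%R. Proof. by case/andP: beta01. Qed.
Let beta1 : (beta < 1)%R. Proof. by case/andP: beta01. Qed.

Definition weight L (h : X -> L.-tuple Y) (z : X * Y) : R :=
  (beta ^+ votes (h z.1) z.2)%R.

Definition potential L (D : probability (X * Y)%type R) (h : X -> L.-tuple Y) : \bar R :=
  \int[D]_z (weight h z)%:E.

Lemma weight_ge0 L (h : X -> L.-tuple Y) z : (0 <= weight h z)%R.
Proof. by rewrite exprn_ge0// ltW. Qed.

Lemma weight_le1 L (h : X -> L.-tuple Y) z : (weight h z <= 1)%R.
Proof. by rewrite exprn_ile1// ltW. Qed.

Lemma votes_le L (t : L.-tuple Y) y : (votes t y <= L)%N.
Proof.
rewrite -[leqRHS]card_ord -sum1_card; apply: leq_sum => i _; exact: leq_b1.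
Qed.

Lemma weight_ge L (h : X -> L.-tuple Y) z : (beta ^+ L <= weight h z)%R.
Proof. by rewrite ler_wiXn2l ?votes_le// ltW. Qed.

Lemma measurable_fun_weight L d (W : measurableType d) (F : W -> X -> L.-tuple Y) :
  measurable_fun setT (fun p : W * X => F p.1 p.2) ->
  measurable_fun setT (fun p : W * Z => weight (F p.1) p.2).
Proof.
move=> mF.
(* The power of [beta] is a product over the votes of factors [beta] or 1, each affine in the
   indicator of the diagonal. *)
have -> : (fun p : W * Z => weight (F p.1) p.2) = (fun p =>
    \prod_(i < L) (1 - (1 - beta) * \1_[set q : Y * Y | q.1 = q.2] (tnth (F p.1 p.2.1) i, p.2.2)))%R.
  apply/funext => p; rewrite /weight /votes -prodrXr; apply: eq_bigr => i _.
  rewrite indicE; case: asboolP => e; [rewrite mem_set//= mulr1|rewrite memNset//= mulr0].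
    by rewrite expr1 subKr.
  by rewrite expr0 subr0.
apply: measurable_prod => i _; apply: measurable_funB => //; apply: measurable_funM => //.
have mg : measurable_fun setT (fun p : W * Z => (tnth (F p.1 p.2.1) i, p.2.2)).
  apply: measurable_fun_pair; last exact: (measurableT_comp measurable_snd measurable_snd).
  have mk : measurable_fun setT (fun p : W * Z => (p.1, p.2.1)).
    by apply: measurable_fun_pair => //; exact: (measurableT_comp measurable_fst measurable_snd).
  exact: (measurableT_comp (measurable_tnth i) (measurableT_comp mF mk)).
apply: (measurableT_comp _ mg); exact/measurable_indicP.
Qed.

Lemma measurable_event_potential L (D : probability (X * Y)%type R) (r : R) :
  measurable_event [set h : X -> L.-tuple Y | potential D h <= r%:E].
Proof.
move=> d W F mF; rewrite -[X in measurable X]setTI; apply: emeasurable_fun_infty_c => //.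
apply: (@measurable_fun_fubini_tonelli_F _ _ _ _ _ D (fun p => (weight (F p.1) p.2)%:E)).
  by have mw := measurable_fun_weight mF; exact/measurable_EFinP.
by move=> p; rewrite lee_fin weight_ge0.
Qed.

(* P stands for D reweighted by the weight of h, with w as normalization. *)
Lemma potential_step L (D P : probability (X * Y)%type R) (h : X -> L.-tuple Y)
    (h' : X -> Y) (w : R) :
  measurable_fun setT h -> measurable_fun setT h' ->
  (0 <= w)%R -> potential D h = w%:E ->
  (forall A, measurable A -> w%:E * P A = \int[D]_(z in A) (weight h z)%:E) ->
  gamma%:E <= P [set z | z.2 = h' z.1] ->
  potential D (fun x => [tuple of h' x :: h x]) <=
    (1 - (1 - beta) * gamma)%:E * potential D h.
Proof.
move=> mh mh' w0 wE wP hg.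
set B := [set z : Z | z.2 = h' z.1] in hg *.
have mB : measurable B.
  by apply: (measurable_fun_agree diagY) => //; exact: (measurableT_comp mh' measurable_fst).
have mw : measurable_fun setT (weight h).
  have := @measurable_fun_weight L _ unit (fun _ => h) (measurableT_comp mh measurable_snd).
  move=> mw'; exact: (measurableT_comp mw' (@pair1_measurable _ _ unit Z tt)).
pose h2 x := [tuple of h' x :: h x].
have mh2 : measurable_fun setT h2 by exact: measurable_cons.
have mw2 : measurable_fun setT (weight h2).
  have := @measurable_fun_weight L.+1 _ unit (fun _ => h2) (measurableT_comp mh2 measurable_snd).
  move=> mw'; exact: (measurableT_comp mw' (@pair1_measurable _ _ unit Z tt)).
have votesE z : votes (h2 z.1) z.2 = (`[< h' z.1 = z.2 >] + votes (h z.1) z.2)%N.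
  rewrite /votes big_ord_recl; congr (_ + _)%N.
  by apply: eq_bigr => i _; rewrite tnthS.
(* Where [h'] is right the weight gains one factor [beta]; elsewhere it is unchanged. *)
have -> : potential D h2 = \int[D]_(z in B) (beta%:E * (weight h z)%:E)
    + \int[D]_(z in ~` B) (weight h z)%:E.
  rewrite /potential -(setUv B) ge0_integral_setU//.
  - congr (_ + _); apply: eq_integral => z; rewrite inE /B /= => zB.
      by rewrite -EFinM /weight votesE asboolT// exprS.
    by rewrite /weight votesE asboolF// => e; apply: zB.
  - exact: measurableC.
  - by apply/measurable_EFinP; rewrite setUv.
  - by move=> z _; rewrite lee_fin weight_ge0.
  - by apply/disj_setPS => z [].
rewrite ge0_integralZl//; last 3 first.
- by apply/measurable_EFinP; exact: measurable_funTS.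
- by move=> z _; rewrite lee_fin weight_ge0.
- by rewrite lee_fin ltW.
rewrite -!wP//; last exact: measurableC.
rewrite probability_setC// wE.
have pE : P B = (fine (P B))%:E by rewrite fineK// fin_num_measure.
move: hg; rewrite pE; set p := fine _; rewrite lee_fin => hg.
rewrite -EFinB -!EFinM -EFinD lee_fin.
(* The right side minus the left side is [w * (1 - beta) * (p - gamma)]. *)
have := mulr_ge0 w0 (mulr_ge0 (ltW (_ : 0 < 1 - beta)%R) (_ : 0 <= p - gamma)%R).
rewrite !subr_gt0 subr_ge0 => /(_ beta1 hg); lra.
Qed.

Let q : R := (1 - (1 - beta) * gamma)%R.

Let q0 : (0 <= q)%R.
Proof. by rewrite subr_ge0 mulr_ile1 ?subr_ge0 ?(ltW beta1)//; [case/andP: gamma01|rewrite gerBl ltW|case/andP: gamma01]. Qed.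

(* The density of the reweighted law is at most beta^-L, so a success
   probability for m-samples from it is lost on samples from D only up to the
   factor beta^(L m). *)
Lemma boosting_rounds m (f : randomized_map R Z X Y m) :
  (forall D, realizable H D ->
    (1 / 2)%:E <= success f D [set h | gamma%:E <= D [set z | z.2 = h z.1]]) ->
  forall L, exists n (g : randomized_map R Z X (L.-tuple Y) n) (c : R),
    (0 < c <= 1)%R /\ forall D, realizable H D ->
    c%:E <= success g D [set h | potential D h <= (q ^+ L)%:E].
Proof.
move=> f_weak; elim=> [|L [n [g [c [/andP[c0 c1] IH]]]]].
  have m0 : measurable_fun setT (fun p : 0.-tuple Z * unit * X => [tuple] : 0.-tuple Y).
    exact: measurable_cst.
  exists 0%N, (@RandomizedMap R _ _ _ Z X (0.-tuple Y) 0 _ unit \d_tt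
    (fun _ _ _ => [tuple]) m0), 1%R; split=> [|D _]; first by rewrite ltr01 lexx.
  rewrite /success (_ : [set p | _] = setT).
    pose P : probability (0.-tuple Z * unit)%type R := iid D 0 \x \d_tt.
    by rewrite -(probability_setT P).
  apply/seteqP; split=> // p _ /=; rewrite /potential expr0.
  rewrite (eq_integral (cst 1)) ?integral_cst_probability// => z _.
  by rewrite /weight /votes big_ord0 expr0.
pose W1 : measurableType _ := (n.-tuple Z * seed g)%type.
pose W2 : measurableType _ := (m.-tuple Z * seed f)%type.
pose F (w : W1 * W2) (x : X) : L.+1.-tuple Y :=
  [tuple of output w.2.1 w.2.2 x :: output w.1.1 w.1.2 x].
have mF : measurable_fun setT (fun p => F p.1 p.2).
  apply: measurable_cons.
    have mg : measurable_fun setT (fun p : W1 * W2 * X => (p.1.2, p.2)).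
      by apply: measurable_fun_pair => //; exact: (measurableT_comp measurable_snd measurable_fst).
    exact: (measurableT_comp (@measurable_output _ _ _ _ _ _ _ _ f) mg).
  have mg : measurable_fun setT (fun p : W1 * W2 * X => (p.1.1, p.2)).
    by apply: measurable_fun_pair => //; exact: (measurableT_comp measurable_fst measurable_fst).
  exact: (measurableT_comp (@measurable_output _ _ _ _ _ _ _ _ g) mg).
(* Weights are at most 1 and their mean is at least [beta ^+ L], so [a] bounds the density of the
   reweighted law. A success probability of one half under that law leaves [c'] under [D]. *)
pose a : R := ((beta ^+ L)^-1)%R.
have bL0 : (0 < beta ^+ L)%R by rewrite exprn_gt0.
have a0 : (0 < a)%R by rewrite invr_gt0.
pose c' : R := ((a ^+ m)^-1 / 2)%R.
have am0 : (0 < a ^+ m)%R by rewrite exprn_gt0.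
have c'0 : (0 < c')%R by rewrite divr_gt0// invr_gt0.
have a1 : (1 <= a)%R by rewrite invf_ge1// exprn_ile1// ltW.
have c'1 : (c' <= 1)%R.
  by rewrite ler_pdivrMr// mul1r (@le_trans _ _ 1%R)// ?ler1n// invf_le1// exprn_ege1.
exists (n + m)%N, (seq_map (seed_law g) (seed_law f) mF), (c * c')%R; split.
  by rewrite mulr_gt0//= mulr_ile1// ltW.
move=> D HD; rewrite success_seq_map; last exact: measurable_event_potential.
pose P1 : probability W1 R := iid D n \x seed_law g.
pose P2 : probability W2 R := iid D m \x seed_law f.
have mB := measurable_event_potential D (q ^+ L.+1) mF.
apply: (@product_measure1_ge _ _ _ _ R P1 P2
  [set p : W1 | potential D (output (r := g) p.1 p.2) <= (q ^+ L)%:E]).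
- exact: (measurable_success (A := g) (measurable_event_potential D _)).
- exact: mB.
- exact: ltW.
- exact: IH.
(* With the first block fixed, [h] and the law [P] built from it are deterministic, and the second
   block is independent of them. *)
move=> w1 /= hw1; set h := output w1.1 w1.2 in hw1.
have mh : measurable_fun setT h by exact: measurable_fun_output.
have mw : measurable_fun setT (weight h).
  have := @measurable_fun_weight L _ unit (fun _ => h) (measurableT_comp mh measurable_snd).
  by move=> mw'; exact: (measurableT_comp mw' (@pair1_measurable _ _ unit Z tt)).
have W_ge : (beta ^+ L)%:E <= potential D h.
  rewrite -(integral_cst_probability D (beta ^+ L)%:E).
  apply: ge0_le_integral => //.
  - by move=> z _; rewrite lee_fin ltW.
  - exact/measurable_EFinP.
  - by move=> z _; rewrite lee_fin weight_ge.
have W_le : potential D h <= 1.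
  rewrite -[leRHS](integral_cst_probability D 1).
  apply: ge0_le_integral => //.
  - by move=> z _; rewrite lee_fin weight_ge0.
  - exact/measurable_EFinP.
  - by move=> z _; rewrite lee_fin weight_le1.
have [w wE] : exists w, potential D h = w%:E.
  exists (fine (potential D h)); rewrite fineK// ge0_fin_numE.
    exact: le_lt_trans W_le (ltry _).
  by apply: le_trans W_ge; rewrite lee_fin ltW.
have wb : (beta ^+ L <= w)%R by rewrite -lee_fin -wE.
have w0 : (0 < w)%R by exact: lt_le_trans wb.
pose dens z := (w^-1 * weight h z)%R.
have mdens : measurable_fun setT dens by exact: measurable_funM.
have dens0 z : (0 <= dens z)%R by rewrite mulr_ge0 ?weight_ge0// invr_ge0 ltW.
have densE A : measurable A -> \int[D]_(z in A) (dens z)%:E =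
    (w^-1)%:E * \int[D]_(z in A) (weight h z)%:E.
  move=> mA; rewrite -ge0_integralZl//.
  - by apply/measurable_EFinP; exact: measurable_funTS.
  - by move=> z _; rewrite lee_fin weight_ge0.
  - by rewrite lee_fin invr_ge0 ltW.
have dens1 : \int[D]_z (dens z)%:E = 1.
  rewrite densE//; move: wE; rewrite /potential => ->.
  by rewrite -EFinM mulVf// gt_eqF.
have [P PE] := density_probability mdens dens0 dens1.
have wP A : measurable A -> w%:E * P A = \int[D]_(z in A) (weight h z)%:E.
  by move=> mA; rewrite PE densE// muleA -EFinM divff ?gt_eqF// mul1e.
have Pa A : measurable A -> P A <= a%:E * D A.
  move=> mA; rewrite PE -integral_cst//.
  apply: ge0_le_integral => //.
  - by move=> z _; rewrite lee_fin.
  - by apply/measurable_EFinP; exact: measurable_funTS.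
  - move=> z _; rewrite lee_fin -[leRHS]mulr1 /dens; apply: ler_pM => //.
    + by rewrite invr_ge0 ltW.
    + exact: weight_ge0.
    + by rewrite lef_pV2 ?posrE.
    + exact: weight_le1.
have HP := realizable_dominated diagY measH a0 Pa HD.
pose S : set W2 := [set p | gamma%:E <= P [set z | z.2 = output (r := f) p.1 p.2 z.1]].
have mC : measurable [set p : Y * Y | p.2 = p.1].
  by apply: (measurable_fun_agree diagY).
have mS : measurable S.
  exact: (measurable_success (A := f) (measurable_event_accuracy P gamma mC)).
(* The domination concerns the sample only; the seed has the same law on both sides, hence the
   factor 1. *)
have S_ge : c'%:E <= P2 S.
  have := product_measure1_dominated (exprn_ge0 m (ltW a0)) ler01
    (iid_dominated (ltW a0) Pa (m := m))
    (Q := seed_law f) (E := seed_law f) _ mS.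
  have Q1 A : measurable A -> seed_law f A <= 1%:E * seed_law f A by rewrite mul1e.
  move=> /(_ Q1); rewrite mulr1 => dom.
  have := le_trans (f_weak P HP) dom.
  by rewrite -lee_pdivrMl// muleC -EFinM /c' mulrC div1r.
apply: (le_trans S_ge); apply: le_measure; rewrite ?inE//.
  exact: (measurable_section1 w1 mB).
move=> w2 Sw2.
apply: (le_trans (potential_step mh (measurable_fun_output w2) (ltW w0) wE wP Sw2)).
by rewrite exprS EFinM lee_wpmul2l// lee_fin.
Qed.

End boosting.

(** * Lists and weak learners *)

Section postprocessing.
Context (R : realType) (dZ dX dO dO' : measure_display)
  (Z : measurableType dZ) (X : measurableType dX)
  (O : measurableType dO) (O' : measurableType dO')
  (phi : O -> O') (mphi : measurable_fun setT phi).

Lemma measurable_post_map m (A : randomized_map R Z X O m) : measurable_fun setT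
  (fun p : m.-tuple Z * seed A * X => phi (output p.1.1 p.1.2 p.2)).
Proof. exact: (measurableT_comp mphi (@measurable_output _ _ _ _ _ _ _ _ A)). Qed.

Definition post_map m (A : randomized_map R Z X O m) : randomized_map R Z X O' m :=
  @RandomizedMap R _ _ _ Z X O' m _ (seed A) (seed_law A)
    (fun t r x => phi (output t r x)) (@measurable_post_map m A).

End postprocessing.

Section equivalence.
Context (R : realType) (dX dY : measure_display)
  (X : measurableType dX) (Y : measurableType dY)
  (diagY : measurable [set p : Y * Y | p.1 = p.2]) (H : set (X -> Y))
  (measH : forall h : X -> Y, H h -> measurable_fun setT h).

Lemma measurable_label_eq : measurable [set p : Y * Y | p.2 = p.1].
Proof. exact: (measurable_fun_agree diagY). Qed.

Lemma measurable_mem_tuple k : measurable [set q : k.-tuple Y * Y | q.2 \in q.1].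
Proof.
rewrite (_ : [set q | _] = \bigcup_(i in [set: 'I_k]) [set q | q.2 = tnth q.1 i]).
  apply: fin_bigcup_measurable; first exact: finite_finset.
  move=> i _; apply: (measurable_fun_agree diagY) => //.
  exact: (measurableT_comp (measurable_tnth i) measurable_fst).
by apply/seteqP; split=> q /= => [/tnthP[i]|[i _ ->]]; [exists i|exact: mem_tnth].
Qed.

Lemma list_to_weak k (gamma : R) : (0 < k)%N -> (k%:R * gamma < 1)%R ->
  list_PAC_learnable R H k -> @weak_PAC_learnable R _ _ _ _ H gamma.
Proof.
case: k => // k _ kg [A [m AP]].
have k0 : (0 < k.+1%:R :> R)%R by [].
(* Since [1 - 2 * eps] is [k.+1 * gamma], the pigeonhole accuracy [(1 - eps) / k.+1] minus the
   validation loss [eta] is exactly [gamma]. *)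
pose eps : R := ((1 - k.+1%:R * gamma) / 2)%R.
have eps0 : (0 < eps)%R by rewrite divr_gt0// subr_gt0.
pose eta : R := (eps / k.+1%:R)%R.
have eta0 : (0 < eta)%R by rewrite divr_gt0.
have epsE : (((1 - eps) / k.+1%:R) - eta = gamma)%R.
  by rewrite /eta /eps; move: k0; set x := (k.+1%:R : R); move=> k0; field; rewrite gt_eqF.
pose A0 : algorithm R (X * Y)%type X Y := fun n => post_map (measurable_tnth (ord0 : 'I_k.+1)) (A n).
have fixed (e : R) : (0 < e)%R -> exists n (f : randomized_map R (X * Y)%type X Y n),
    forall D, realizable H D ->
      (1 - e)%:E <= success f D [set h | gamma%:E <= accuracy D [set p : Y * Y | p.2 = p.1] h].
  (* Learning and validation each fail with probability at most [e'], and
     [(1 - e') ^+ 2 >= 1 - 2 * e' >= 1 - e]. *)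
  move=> e0; pose e' := (Num.min e 1 / 2)%R.
  have e'0 : (0 < e')%R by rewrite divr_gt0// lt_min e0 ltr01.
  have e'1 : (e' <= 1)%R by rewrite ler_pdivrMr// ge_min; apply/orP; right; lra.
  have e'e : (e' * 2 <= e)%R by rewrite divfK// ge_min lexx.
  have e'01 : (0 < e' <= 1)%R by rewrite e'0.
  have [n [g gP]] := validate measurable_label_eq (A (m eps e')) eta0 e'01.
  exists n, g => D HD; rewrite -epsE.
  have AD := AP D HD eps e' eps0 e'0 _ (leqnn _).
  apply: le_trans (gP D _ (1 - e')%R _); last first.
    apply: (le_trans AD); apply: success_le.
    - exact: (measurable_event_accuracy D (1 - eps) (@measurable_mem_tuple k.+1)).
    - exact: measurable_event_exists (measurable_event_accuracy _ _ measurable_label_eq).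
    (* If every coordinate had accuracy below [(1 - eps) / k.+1], the union bound would put the list
       below [1 - eps]. *)
    move=> mu mmu /= mu_ge; apply: contrapT => /forallNP small.
    have mA i : measurable [set z : X * Y | z.2 = tnth (mu z.1) i].
      apply: (measurable_fun_agree diagY) => //.
      exact: (measurableT_comp (measurable_tnth i) (measurableT_comp mmu measurable_fst)).
    pose B (j : nat) := [set z : X * Y | z.2 = tnth (mu z.1) (inord j : 'I_k.+1)].
    have cover : [set z : X * Y | z.2 \in mu z.1] `<=` \big[setU/set0]_(j < k.+1) B j.
      move=> z /= /tnthP[i zi]; rewrite -bigcup_mkord; exists (val i) => //=.
      by rewrite /B /= inord_val.
    have : D [set z : X * Y | z.2 \in mu z.1] < (1 - eps)%:E.
      apply: (@le_lt_trans _ _ (\sum_(j < k.+1) D (B j))).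
        apply: le_trans (Boole_inequality D _); last by move=> j _; exact: mA.
        apply: le_measure => //; rewrite ?inE.
          have mg : measurable_fun setT (fun z : X * Y => (mu z.1, z.2)).
            by apply: measurable_fun_pair => //; exact: (measurableT_comp mmu measurable_fst).
          exact: (measurable_preim mg (@measurable_mem_tuple k.+1)).
        by apply: bigsetU_measurable => j _; exact: mA.
      have -> : (1 - eps)%:E = \sum_(j < k.+1) ((1 - eps) / k.+1%:R)%:E.
        by rewrite sumEFin sumr_const card_ord; congr (_%:E); rewrite -[RHS]mulr_natr divfK// gt_eqF.
      have finB (j : 'I_k.+1) : D (B j) = (fine (D (B j)))%:E.
        by rewrite fineK// fin_num_measure//; exact: mA.
      rewrite (eq_bigr _ (fun j _ => finB j)) !sumEFin lte_fin.
      apply: ltr_sum => [|j _]; first by apply/hasP; exists ord0 => //; rewrite mem_index_enum.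
      by rewrite -lte_fin -finB ltNge; apply/negP; exact: small.
    by rewrite ltNge mu_ge.
  rewrite lee_fin; have := sqr_ge0 e'; nra.
have [B [mB BP]] := learnable_of_fixed measurable_label_eq A0 (fun _ _ _ => lexx gamma) fixed.
by exists B, mB => D HD delta delta0 n nm; exact: BP.
Qed.

Lemma weak_to_list K (gamma : R) : (1 < K)%N -> (0 <= gamma <= 1)%R ->
  (1 < K%:R * gamma)%R ->
  @weak_PAC_learnable R _ _ _ _ H gamma -> list_PAC_learnable R H K.-1.
Proof.
move=> K1 g01 Kg [A [m AP]].
have K0 : (0 < K)%N by exact: ltnW.
have [beta b01 brate] := boosting_rate g01 Kg.
have [b0 b1] := andP b01.
set q := (1 - (1 - beta) * gamma)%R in brate.
have q0 : (0 <= q)%R.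
  by case/andP: g01 => g0 g1; rewrite subr_ge0 mulr_ile1 ?subr_ge0 ?(ltW b1)// gerBl ltW.
pose C := [set p : K.-1.-tuple Y * Y | p.2 \in p.1].
have mC : measurable C by exact: measurable_mem_tuple.
have half0 : (0 < 1 / 2 :> R)%R by rewrite divr_gt0.
have f_weak D : realizable H D -> (1 / 2)%:E <=
    success (A (m (1 / 2)%R)) D [set h | gamma%:E <= D [set z | z.2 = h z.1]].
  by move=> HD; have := AP D HD (1 / 2)%R half0 _ (leqnn _); rewrite (_ : 1 - 1 / 2 = 1 / 2)%R//; field.
have fixed (e : R) : (0 < e)%R ->
    exists n (f : randomized_map R (X * Y)%type X (K.-1.-tuple Y) n),
    forall D, realizable H D ->
      (1 - e)%:E <= success f D [set h | (1 - e)%:E <= accuracy D C h].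
  move=> e0; pose e' := (Num.min e 1 / 2)%R.
  have e'0 : (0 < e')%R by rewrite divr_gt0// lt_min e0 ltr01.
  have e'1 : (e' <= 1)%R by rewrite ler_pdivrMr// ge_min; apply/orP; right; lra.
  have e'e : (e' * 2 <= e)%R by rewrite divfK// ge_min lexx.
  have e'01 : (0 < e' <= 1)%R by rewrite e'0.
  have rho01 : (0 <= q ^+ K / beta < 1)%R.
    by rewrite divr_ge0 ?exprn_ge0 ?(ltW b0)//= ltr_pdivrMr// mul1r.
  (* [rho_c] is the Markov bound on the mass of examples with at most [c] votes out of [K * c]. *)
  have [c rho_c] := exists_expr_le rho01 e'0.
  have [n [g [c0 [/andP[c00 c01] gP]]]] := boosting_rounds diagY measH b01 g01 f_weak (K * c).
  have [maj [mmaj majP]] := heavy_labels diagY c K0.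
  have c1 : (0 <= 1 - c0 < 1)%R by rewrite subr_ge0 c01 gtrBl.
  (* [c0] is uniform in [D], hence so is the number of repetitions. One more run is made below
     because validation takes a nonempty tuple. *)
  have [N cN] := exists_expr_le c1 e'0.
  have [n1 [r rP]] := repeat_map (post_map mmaj g) N.+1.
  have [n2 [s sP]] := validate mC r e'0 e'01.
  exists n2, s => D HD.
  have step1 : c0%:E <= success (post_map mmaj g) D [set h | (1 - e')%:E <= accuracy D C h].
    have -> : success (post_map mmaj g) D [set h | (1 - e')%:E <= accuracy D C h] =
        success g D [set h : X -> (K * c).-tuple Y | (1 - e')%:E <= accuracy D C (fun x => maj (h x))] by [].
    apply: (le_trans (gP D HD)).
    apply: success_le.
    - exact: measurable_event_potential.
    - move=> d W F mF; exact: (measurable_event_accuracy D (1 - e') mC (measurableT_comp mmaj mF)).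
    move=> h mh /= hpot.
    pose Bad := [set z : X * Y | (votes (h z.1) z.2 <= c)%N].
    have mw : measurable_fun setT (weight beta h).
      have := @measurable_fun_weight R _ _ X Y diagY beta _ _ unit (fun _ => h) (measurableT_comp mh measurable_snd).
      by move=> mw'; exact: (measurableT_comp mw' (@pair1_measurable _ _ unit (X * Y)%type tt)).
    have BadE : Bad = [set z | (beta ^+ c <= weight beta h z)%R].
      by apply/seteqP; split=> z /=; rewrite /Bad /weight /= ler_iXn2l.
    have mBad : measurable Bad by rewrite BadE; exact: measurable_set_ge.
    (* Markov's inequality: on [Bad] the weight is at least [beta ^+ c], and its mean is at most
       [q ^+ (K * c)]. *)
    have Bad_le : D Bad <= e'%:E.
      have bc0 : (0 < beta ^+ c)%R by rewrite exprn_gt0.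
      have : (beta ^+ c)%:E * D Bad <= (q ^+ (K * c))%:E.
        apply: le_trans hpot; rewrite -integral_cst//.
        apply: (@le_trans _ _ (\int[D]_(z in Bad) (weight beta h z)%:E)).
          apply: ge0_le_integral => //.
          - by move=> z _; rewrite lee_fin ltW.
          - by apply/measurable_EFinP; exact: measurable_funTS.
          - by move=> z; rewrite BadE /= lee_fin.
        apply: ge0_subset_integral => //.
        - exact/measurable_EFinP.
        - by move=> z _; rewrite lee_fin weight_ge0.
      rewrite -lee_pdivlMl// -EFinM => /le_trans; apply.
      rewrite lee_fin; apply: le_trans rho_c.
      by rewrite expr_div_n exprM mulrC.
    have mg : measurable_fun setT (fun z : X * Y => (maj (h z.1), z.2)).
      by apply: measurable_fun_pair => //; exact: (measurableT_comp mmaj (measurableT_comp mh measurable_fst)).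
    apply: (@le_trans _ _ (D (~` Bad))).
      by rewrite probability_setC// EFinB leeB.
    apply: le_measure; rewrite ?inE.
    - exact: measurableC.
    - exact: (measurable_preim mg mC).
    by move=> z /= /negP; rewrite -ltnNge => zv; exact: majP.
  have step2 := rP D _ _ (measurable_event_accuracy D (1 - e') mC) step1.
  have step3 := sP D _ _ step2.
  (* Repetition and validation cost [e'] each in confidence; voting and validation cost [e'] each in
     accuracy. *)
  apply: (@le_trans _ _ ((1 - (1 - c0) ^+ N.+1) * (1 - e'))%:E).
    rewrite lee_fin; have cN1 : ((1 - c0) ^+ N.+1 <= e')%R.
      apply: le_trans cN; rewrite exprS ler_piMl ?exprn_ge0//; last by lra.
      by case/andP: c1.
    have := sqr_ge0 e'; nra.
  apply: (le_trans step3); apply: success_le; [exact: measurable_event_accuracy..|].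
  by move=> h _ /=; apply: le_trans; rewrite lee_fin; lra.
(* A filler for small samples: the prediction of [A], repeated [K.-1] times. *)
pose A0 : algorithm R (X * Y)%type X (K.-1.-tuple Y) := fun n =>
  post_map (@measurable_mktuple _ Y _ Y K.-1 (fun _ y => y) (fun _ => @measurable_id _ Y setT)) (A n).
have Tmono (e e' : R) : (e' <= e -> 1 - e <= 1 - e')%R by move=> ?; rewrite lerB.
have [B [mB BP]] := learnable_of_fixed mC A0 Tmono fixed.
(* [B] has a single parameter for error and confidence; the smaller of the two serves both. *)
exists B, (fun eps delta => mB (Num.min eps delta)) => D HD eps delta eps0 delta0 n nm.
have min0 : (0 < Num.min eps delta)%R by rewrite lt_min eps0.
apply: le_trans (le_trans (BP D HD _ min0 n nm) _).
  by rewrite lee_fin lerB// ge_min lexx orbT.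
apply: success_le; first exact: (measurable_event_accuracy D _ mC).
  exact: (measurable_event_accuracy D (1 - eps) mC).
by move=> h _ /=; apply: le_trans; rewrite lee_fin lerB// ge_min lexx.
Qed.

End equivalence.

(* The weak learning threshold as the inverse of the list number *)
Local Close Scope ereal_scope.

Theorem theorem3 (R : realType) (dX dY : measure_display)
    (X : measurableType dX) (Y : measurableType dY)
    (diagY : measurable [set p : Y * Y | p.1 = p.2])
    (H : set (X -> Y))
    (measH : forall h : X -> Y, H h -> measurable_fun setT h)
    (kfin : list_number_finite R H) :
  (list_number kfin)%:R * weak_number R H = 1.
Proof.
rewrite /list_number; case: ex_minnP => K /asboolP[K0 listK] Kmin.
have K0' : 0 < K%:R :> R by rewrite ltr0n.
rewrite /weak_number; set S := [set gamma | _].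
have S_le gamma : S gamma -> gamma <= K%:R^-1.
  (* For [K = 1] the bound is [gamma <= 1]. Otherwise [K.-1] is positive, and a larger [gamma] would
     contradict the minimality of [K]. *)
  move=> [g01 weakg]; have [K1|K1] := leqP K 1.
    have -> : K = 1%N by apply/eqP; rewrite eqn_leq K1.
    by rewrite invr1; case/andP: g01.
  rewrite leNgt; apply/negP => gK.
  have Kg : 1 < K%:R * gamma by rewrite -ltr_pdivrMl// mulr1.
  have /Kmin : `[< (0 < K.-1)%N /\ list_PAC_learnable R H K.-1 >].
    apply/asboolP; split; first by rewrite -ltnS prednK.
    exact: weak_to_list g01 Kg weakg.
  by rewrite leqNgt prednK// leqnn.
have S_mem gamma : 0 <= gamma < K%:R^-1 -> S gamma.
  move=> /andP[g0 gK]; split.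
    rewrite g0 (le_trans (ltW gK))// invf_le1// ler1n//.
  apply: list_to_weak listK => //.
  by rewrite -ltr_pdivlMl// mulr1.
have Kinv0 : 0 < K%:R^-1 :> R by rewrite invr_gt0.
have S0 : S 0 by apply: S_mem; rewrite lexx.
have supS : has_sup S by split; [exists 0|exists K%:R^-1 => g /S_le].
suff -> : sup S = K%:R^-1 by rewrite divff// gt_eqF.
apply/eqP; rewrite eq_le; apply/andP; split.
  by apply: ge_sup => //; exists 0.
rewrite leNgt; apply/negP => supK.
have sup0 : 0 <= sup S by exact: ub_le_sup supS.2 _ S0.
(* If the supremum were below [K%:R^-1], their midpoint would lie in [S] and exceed the supremum. *)
have : (sup S + K%:R^-1) / 2 <= sup S.
  by apply: ub_le_sup supS.2 _ _; apply: S_mem; lra.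
lra.
Qed.
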